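(* Let $\mathbf F$ be a Fraïssé structure, and let $\mathcal A$ be a unital, left-invariant, closed C$^*$-subalgebra of $\mathrm{RUC}_b(\mathrm{Aut}(\mathbf F))$. The following are equivalent: (i) The flow $\mathrm{Aut}(\mathbf F)\curvearrowright\mathrm{Aut}(\mathbf F)^{\mathcal A}$ has a fixed point. (ii) For every $\varepsilon>0$, $\mathbf F$ has the Ramsey property up to $2\varepsilon$ for the finite colorings in $(\mathcal A)_\varepsilon$. Those imply the following two statements, which are equivalent to each other: (iii) Every zero-dimensional factor of $\mathrm{Aut}(\mathbf F)\curvearrowright\mathrm{Aut}(\mathbf F)^{\mathcal A}$ has a fixed point. (iv) $\mathbf F$ has the Ramsey property for the finite colorings in $\mathcal A$. When the finite colorings (belonging to $\mathcal A$) are norm-dense in $\mathcal A$, all four statements (i)–(iv) are equivalent.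
   Context: Structures. Languages are first-order and relational; a structure is a non-empty set with interpretations of the relation symbols. An embedding is an isomorphism onto its image; $\binom{\mathbf B}{\mathbf A}$ denotes the set of all embeddings of $\mathbf A$ into $\mathbf B$. A Fraïssé structure is a countable ultrahomogeneous structure (every isomorphism between finite substructures extends to an automorphism). $\mathrm{Age}(\mathbf F)$ is the set of all finite substructures of $\mathbf F$. $G=\mathrm{Aut}(\mathbf F)$ is a topological group for which the pointwise stabilizers of finite substructures form a basis of neighborhoods of the identity. Functions and compactifications. $\mathrm{RUC}_b(G)$ is the C$^*$-algebra (supremum norm) of bounded right-uniformly continuous functions $f:G\to\mathbb C$: for every $\varepsilon>0$ there is a neighborhood $U$ of the identity such that $gh^{-1}\in U$ implies $|f(g)-f(h)|<\varepsilon$. $G$ acts on it by left shift $(g\cdot f)(h)=f(g^{-1}h)$; left-invariant means invariant under this action. $G^{\mathcal A}$ is the Gelfand space of $\mathcal A$ (unital C$^*$-homomorphisms $\phi:\mathcal A\to\mathbb C$, weak$^*$ topology), a $G$-flow under $(g\cdot\phi)(f)=\phi(g^{-1}\cdot f)$. A $G$-flow is a continuous left action on a non-empty compact Hausdorff space; a factor of $G\curvearrowright X$ is a $G$-flow $G\curvearrowright Y$ with a continuous $G$-equivariant surjection $X\to Y$; it is zero-dimensional when $Y$ is. $(\mathcal A)_\varepsilon$ is the set of $f\in\mathrm{RUC}_b(G)$ with $\|f-\alpha\|_\infty<\varepsilon$ for some $\alpha\in\mathcal A$. Colorings. For a finite substructure $\mathbf A\subset\mathbf F$, a coloring $\bar\chi:\binom{\mathbf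 F}{\mathbf A}\to\mathbb C$ is identified with the function $\chi(g)=\bar\chi(g^{-1}\upharpoonright A)$ on $G$; it is finite when its range is finite, and finite colorings are thus elements of $\mathrm{RUC}_b(G)$. For $\mathcal F\subset\mathrm{RUC}_b(G)$ and $\varepsilon>0$, $\mathbf F$ has the Ramsey property (resp. Ramsey property up to $\varepsilon$) for colorings in $\mathcal F$ when for all $\mathbf A,\mathbf B\in\mathrm{Age}(\mathbf F)$ and every finite set $\mathcal C\subset\mathcal F$ of finite colorings of $\binom{\mathbf F}{\mathbf A}$, there is $b\in\binom{\mathbf F}{\mathbf B}$ such that every $\chi\in\mathcal C$ is constant (resp. constant up to $\varepsilon$, i.e. any two values differ by less than $\varepsilon$ in modulus) on $\binom{b(\mathbf B)}{\mathbf A}$. *)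

(* Defs.v *)
(* MathComp-Analysis; the complex field is [R[i]] over [R : realType]. *)
From HB Require Import structures.
From mathcomp Require Import all_boot all_order all_algebra.
From mathcomp Require Import all_classical all_reals all_analysis.
From mathcomp Require Import complex.

Set Implicit Arguments.
Unset Strict Implicit.
Unset Printing Implicit Defensive.

Import Order.TTheory GRing.Theory Num.Theory.
Import numFieldNormedType.Exports.
Import Normc.

Local Open Scope classical_set_scope.
Local Open Scope ring_scope.

Record language := Language { symb : Type; arity : symb -> nat }.

Record structure (L : language) := Structure {
  dom :> Type;
  interp : forall s : symb L, ('I_(arity s) -> dom) -> Prop;
  dom_inhabited : inhabited dom }.

Record embedding (L : language) (M N : structure L) := Embedding {
  emb_fun :> M -> N;
  emb_inj : injective emb_fun;
  emb_interp : forall (s : symb L) (t : 'I_(arity s) -> M),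
    interp (emb_fun \o t) <-> interp t }.

(* [age F] lists the finite substructures of F themselves, not their
   isomorphism types; as the language is relational, they are the non-empty
   finite subsets of F with the induced relations. *)
Record age (L : language) (F : structure L) := Age {
  age_set : set F;
  age_finite : finite_set age_set;
  age_nonempty : age_set !=set0 }.

Section Substructures.
Context {L : language} {F : structure L}.

Lemma age_inhabited (S : age F) : inhabited (set_type (age_set S)).
Proof. by have [x Sx] := age_nonempty S; constructor; exists x; exact: mem_set. Qed.

Definition substr (S : age F) : structure L :=
  @Structure L (set_type (age_set S))
    (fun s t => @interp L F s (set_val \o t)) (age_inhabited S).

Lemma age_setU (S T : age F) :
  finite_set (age_set S `|` age_set T) /\ age_set S `|` age_set T !=set0.
Proof.
split; first by rewrite finite_setU; split; exact: age_finite.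
by have [x Sx] := age_nonempty S; exists x; left.
Qed.

Definition ageU (S T : age F) : age F := Age (age_setU S T).1 (age_setU S T).2.

Lemma age_set1 (x : F) : finite_set [set x] /\ [set x] !=set0.
Proof. by split; [exact: finite_set1 | exists x]. Qed.

Definition age1 (x : F) : age F := Age (age_set1 x).1 (age_set1 x).2.

End Substructures.

Coercion substr : age >-> structure.

Record aut (L : language) (F : structure L) := Aut {
  aut_fun :> F -> F;
  aut_inv : F -> F;
  aut_funK : cancel aut_fun aut_inv;
  aut_invK : cancel aut_inv aut_fun;
  aut_interp : forall (s : symb L) (t : 'I_(arity s) -> F),
    interp (aut_fun \o t) <-> interp t }.

Section AutGroup.
Context {L : language} {F : structure L}.
Implicit Types g h : aut F.

Lemma aut_eq g h : g =1 h -> g = h.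
Proof.
case: g h => [g g' gK g'K gI] [h h' hK h'K hI] /= /funext gh.
move: gK g'K gI; rewrite gh => gK g'K gI.
have gh' : g' = h' by apply/funext => x; rewrite -[x in LHS]h'K gK.
move: gK g'K; rewrite gh' => gK g'K.
by congr Aut; exact: Prop_irrelevance.
Qed.

Definition aut1 : aut F :=
  @Aut L F id id (fun=> erefl) (fun=> erefl) (fun s t => iff_refl _).

Lemma aut_mul_interp g h (s : symb L) (t : 'I_(arity s) -> F) :
  interp ((g \o h) \o t) <-> interp t.
Proof.
have /= -> := aut_interp g (h \o t); exact: aut_interp.
Qed.

Definition aut_mul g h : aut F :=
  Aut (can_comp (aut_funK g) (aut_funK h))
    (can_comp (aut_invK h) (aut_invK g)) (@aut_mul_interp g h).

Lemma aut_inv_interp g (s : symb L) (t : 'I_(arity s) -> F) :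
  interp (aut_inv g \o t) <-> interp t.
Proof.
rewrite -(aut_interp g (aut_inv g \o t)).
suff -> : g \o (aut_inv g \o t) = t by [].
by apply/funext => i /=; rewrite aut_invK.
Qed.

Definition aut_invg g : aut F :=
  Aut (aut_invK g) (aut_funK g) (@aut_inv_interp g).

Lemma aut_mulA : associative aut_mul.
Proof. by move=> g h k; exact: aut_eq. Qed.
Lemma aut_mul1g : left_id aut1 aut_mul.
Proof. by move=> g; exact: aut_eq. Qed.
Lemma aut_mulg1 : right_id aut1 aut_mul.
Proof. by move=> g; exact: aut_eq. Qed.
Lemma aut_mulVg : left_inverse aut1 aut_invg aut_mul.
Proof. by move=> g; apply: aut_eq => x /=; rewrite aut_funK. Qed.
Lemma aut_mulgV : right_inverse aut1 aut_invg aut_mul.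
Proof. by move=> g; apply: aut_eq => x /=; rewrite aut_invK. Qed.

End AutGroup.

HB.instance Definition _ (L : language) (F : structure L) :=
  gen_eqMixin (aut F).
HB.instance Definition _ (L : language) (F : structure L) :=
  gen_choiceMixin (aut F).
HB.instance Definition _ (L : language) (F : structure L) :=
  isGroup.Build (aut F) aut_mulA aut_mul1g aut_mulg1 aut_mulVg aut_mulgV.

Section AutTopology.
Context {L : language} {F : structure L}.

Definition stabilizer (S : age F) : set (aut F) :=
  [set s | forall x, age_set S x -> s x = x].

Definition aut_nbhs (g : aut F) : set_system (aut F) :=
  [set U | exists S : age F, forall s, stabilizer S s -> U (g * s)%g].

HB.instance Definition _ := hasNbhs.Build (aut F) aut_nbhs.

Lemma aut_nbhs_filter (g : aut F) : ProperFilter (nbhs g).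
Proof.
apply: Build_ProperFilter_ex.
  by move=> U [S SU]; exists (g * 1)%g; apply: SU.
split.
- by case: (dom_inhabited F) => x; exists (age1 x).
- move=> U V [S SU] [T TV]; exists (ageU S T) => s sST; split.
    by apply: SU => x Sx; apply: sST; left.
  by apply: TV => x Tx; apply: sST; right.
- by move=> U V UV [S SU]; exists S => s /SU /UV.
Qed.

Lemma aut_nbhs_singleton (g : aut F) (U : set (aut F)) : nbhs g U -> U g.
Proof. by case=> S SU; rewrite -[g]mulg1; apply: SU. Qed.

Lemma aut_nbhs_nbhs (g : aut F) (U : set (aut F)) :
  nbhs g U -> nbhs g (nbhs^~ U).
Proof.
case=> S SU; exists S => s Ss; exists S => t St; rewrite -mulgA.
by apply: SU => x Sx /=; rewrite (St _ Sx) (Ss _ Sx).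
Qed.

HB.instance Definition _ := Nbhs_isNbhsTopological.Build (aut F)
  aut_nbhs_filter aut_nbhs_singleton aut_nbhs_nbhs.

End AutTopology.

Section Fraisse.
Context {L : language}.

Definition isomorphism (M N : structure L) (f : embedding M N) : Prop :=
  range f = [set: N].

Definition ultrahomogeneous (F : structure L) : Prop :=
  forall (S T : age F) (f : embedding S T), isomorphism f ->
    exists g : aut F, forall x : S, g (set_val x) = set_val (f x).

Definition fraisse (F : structure L) : Prop :=
  countable [set: F] /\ ultrahomogeneous F.

End Fraisse.

Section Flows.
Context {L : language} {F : structure L}.
Local Notation G := (aut F).

Record is_flow (X : topologicalType) (act : G -> X -> X) : Prop := IsFlow {
  flow_nonempty : [set: X] !=set0;
  flow_compact : compact [set: X];
  flow_hausdorff : hausdorff_space X;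
  flow_act1 : forall x, act 1%g x = x;
  flow_actM : forall g h x, act (g * h)%g x = act g (act h x);
  flow_continuous : continuous (fun p : G * X => act p.1 p.2) }.

Definition is_factor (X Y : topologicalType)
    (actX : G -> X -> X) (actY : G -> Y -> Y) : Prop :=
  is_flow actY /\
  exists p : X -> Y, [/\ continuous p, range p = [set: Y]
    & forall g x, p (actX g x) = actY g (p x)].

Definition has_fixed_point (X : Type) (act : G -> X -> X) : Prop :=
  exists x, forall g, act g x = x.

End Flows.

(* The usual notion. The library's [zero_dimensional] is point separation by
   clopen sets, which agrees with it on compact Hausdorff spaces. *)
Definition zero_dim (X : topologicalType) : Prop := basis (@clopen X).

Section Algebras.
Context {R : realType} {L : language} {F : structure L}.
Local Notation C := (R[i]).
Local Notation G := (aut F).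
Implicit Types (f : G -> C) (g h : G).

(* Meaningful for bounded functions only: [sup] is 0 on unbounded sets. *)
Definition supnorm f : R := sup (range (fun g => normc (f g))).

Definition RUCb : set (G -> C) :=
  [set f | (exists M : R, forall g, normc (f g) <= M) /\
    forall eps : R, 0 < eps -> exists2 U : set G, nbhs (1%g : G) U &
      forall g h, U (g * h^-1)%g -> normc (f g - f h) < eps].

Definition lshift g f : G -> C := fun h => f (g^-1 * h)%g.

Definition conj_fun f : G -> C := fun g => (f g)^*.

End Algebras.

Record inv_cstar_subalgebra (R : realType) (L : language) (F : structure L) :=
  InvCstarSubalgebra {
  cs_set :> set (aut F -> R[i]);
  cs_RUCb : cs_set `<=` RUCb;
  cs_one_subproof : cs_set (cst 1);
  cs_add_subproof : forall f h, cs_set f -> cs_set h -> cs_set (f \+ h);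
  cs_scale_subproof : forall c f, cs_set f -> cs_set (c \*o f);
  cs_mul_subproof : forall f h, cs_set f -> cs_set h -> cs_set (f \* h);
  cs_conj_subproof : forall f, cs_set f -> cs_set (conj_fun f);
  cs_closed : forall f, RUCb f ->
    (forall eps : R, 0 < eps ->
      exists2 h, cs_set h & supnorm (f \- h) < eps) -> cs_set f;
  cs_lshift_subproof : forall g f, cs_set f -> cs_set (lshift g f) }.

Section Gelfand.
Context {R : realType} {L : language} {F : structure L}.
Variable A : inv_cstar_subalgebra R F.
Local Notation C := (R[i]).
Local Notation G := (aut F).

Definition cs_one : set_type A := SigSub (mem_set (cs_one_subproof A)).
Definition cs_add (f h : set_type A) : set_type A :=
  SigSub (mem_set (cs_add_subproof (set_valP f) (set_valP h))).
Definition cs_scale (c : C) (f : set_type A) : set_type A :=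
  SigSub (mem_set (cs_scale_subproof c (set_valP f))).
Definition cs_mul (f h : set_type A) : set_type A :=
  SigSub (mem_set (cs_mul_subproof (set_valP f) (set_valP h))).
Definition cs_conj (f : set_type A) : set_type A :=
  SigSub (mem_set (cs_conj_subproof (set_valP f))).
Definition cs_lshift (g : G) (f : set_type A) : set_type A :=
  SigSub (mem_set (cs_lshift_subproof g (set_valP f))).

Record is_character (phi : set_type A -> C) : Prop := IsCharacter {
  char_one : phi cs_one = 1;
  char_add : forall f h, phi (cs_add f h) = phi f + phi h;
  char_scale : forall c f, phi (cs_scale c f) = c * phi f;
  char_mul : forall f h, phi (cs_mul f h) = phi f * phi h;
  char_conj : forall f, phi (cs_conj f) = (phi f)^* }.

(* [set_type] carries the subspace topology and [{ptws _ -> _}] that of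
   pointwise convergence, so this is the weak* topology. The cast selects the
   norm topology on R[i]. *)
Definition gelfand : topologicalType :=
  set_type [set phi : {ptws set_type A -> (C : numClosedFieldType)} | is_character phi].

Lemma gelfand_act_subproof (g : G) (phi : gelfand) :
  is_character (fun f => set_val phi (cs_lshift g^-1%g f)).
Proof.
have [phi1 phiD phiZ phiM phiJ] := set_valP phi.
split.
- by rewrite -[RHS]phi1; congr (set_val phi _); exact: val_inj.
- by move=> f h; rewrite -phiD; congr (set_val phi _); exact: val_inj.
- by move=> c f; rewrite -phiZ; congr (set_val phi _); exact: val_inj.
- by move=> f h; rewrite -phiM; congr (set_val phi _); exact: val_inj.
- by move=> f; rewrite -phiJ; congr (set_val phi _); exact: val_inj.
Qed.

Definition gelfand_act (g : G) (phi : gelfand) : gelfand :=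
  SigSub (mem_set (gelfand_act_subproof g phi)).

End Gelfand.

Section Ramsey.
Context {R : realType} {L : language} {F : structure L}.
Local Notation C := (R[i]).
Local Notation G := (aut F).

Lemma restr_inj (g : G) (S : age F) : injective (g \o set_val : S -> F).
Proof. by move=> x y /(can_inj (aut_funK g)) /val_inj. Qed.

Lemma restr_interp (g : G) (S : age F) (s : symb L) (t : 'I_(arity s) -> S) :
  @interp L F s ((g \o set_val : S -> F) \o t) <-> interp t.
Proof. exact: (aut_interp g (set_val \o t)). Qed.

Definition restr (g : G) (S : age F) : embedding S F :=
  Embedding (@restr_inj g S) (@restr_interp g S).

Definition color_fun (S : age F) (chi : embedding S F -> C) : G -> C :=
  fun g => chi (restr g^-1%g S).

Definition finite_coloring (f : G -> C) : Prop :=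
  exists (S : age F) (chi : embedding S F -> C),
    finite_set (range chi) /\ f = color_fun chi.

(* Embeddings of S into the substructure b(T) are taken as the embeddings of S
   into F whose image lies in that of b. *)
Definition ramsey_rel (close : C -> C -> Prop) (Fam : set (G -> C)) : Prop :=
  forall (S T : age F) (Cs : set (embedding S F -> C)),
    finite_set Cs ->
    (forall chi, Cs chi -> finite_set (range chi) /\ Fam (color_fun chi)) ->
    exists b : embedding T F, forall chi, Cs chi ->
      forall e e' : embedding S F, range e `<=` range b ->
        range e' `<=` range b -> close (chi e) (chi e').

Definition ramsey : set (G -> C) -> Prop := ramsey_rel eq.

Definition ramsey_upto (eps : R) : set (G -> C) -> Prop :=
  ramsey_rel (fun z w => normc (z - w) < eps).

Definition thicken (A : set (G -> C)) (eps : R) : set (G -> C) :=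
  [set f | RUCb f /\ exists2 a, A a & supnorm (f \- a) < eps].

Definition finite_colorings_dense (A : set (G -> C)) : Prop :=
  forall f, A f -> forall eps : R, 0 < eps ->
    exists chi, [/\ finite_coloring chi, A chi & supnorm (f \- chi) < eps].

End Ramsey.

(* Main.v *)
Require Import Defs.
From mathcomp Require Import all_boot all_order all_algebra.
From mathcomp Require Import all_classical all_reals all_analysis.
From mathcomp Require Import complex ring lra.
Set Implicit Arguments.
Unset Strict Implicit.
Unset Printing Implicit Defensive.
Import Order.TTheory GRing.Theory Num.Theory.
Import numFieldNormedType.Exports.
Import Normc.
Local Open Scope classical_set_scope.
Local Open Scope ring_scope.

(** Write G for the automorphism group and X for the Gelfand space of A.
Everything rests on comparing three kinds of objects: characters of A,
evaluations at elements of G, and colorings.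

Evaluations are dense in X [evaluations_dense]: if no element of G came close
to a character phi on f_1, ..., f_n, then the sum of the |f_k - phi(f_k)|^2
would be bounded below on G, hence invertible in A, although phi kills it.
Density makes characters contractive, so pointwise limits along ultrafilters
exist and X is compact [gelfand_compact]. As evaluation at g h is the
translate by g of evaluation at h, a fixed point of X amounts to the existence,
for finitely many f in A and g in G and every e > 0, of an h such that f(g h)
and f(h) are e-close: one direction is density, the other takes the limit of
the evaluations along an ultrafilter.

Ultrahomogeneity turns this into Ramsey statements. Every embedding of a finite
substructure extends to an automorphism, so colorings of the copies of S are
the functions on G that are invariant under left multiplication by the
stabilizer of S, and every copy of T inside F is the image of T under h^-1 for
some h in G. For finitely many finite colorings, a copy of T on which each of
them is almost constant is then an h at which the translates of each of them almost agree
[ramsey_almost_invariant, ramsey_witness]. Right uniform continuity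
approximates every function of A uniformly by finite colorings, which gives
(i) <-> (ii); if these colorings can be taken inside A, the exact Ramsey
property suffices.

For (iii) <-> (iv), clopen sets and finite-valued functions correspond. On the
one hand, a clopen subset of X is cut out on G by a function of A
[indicator_in], a case of Stone-Weierstrass proved by hand with products of
rational functions. So, given a zero-dimensional factor, the Ramsey property
for finite colorings in A provides an ultrafilter along which evaluations and
their translates end up in the same clopen sets; its limit is fixed. On the
other hand, the values of characters at the finite-valued functions of A define
a zero-dimensional factor of X, the largest one [finite_factor]; a fixed point
of it is a character that gives all translates of a finite-valued function the
same value, and density of evaluations then yields monochromatic copies. *)

(** * Limits of complex-valued functions *)

Section ComplexLimits.
Context {R : realType}.
Local Notation C := (R[i] : numClosedFieldType).

Lemma normc_norm (z : C) : `|z| = (normc z)%:C%C.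
Proof. by []. Qed.

Lemma normc_ge0 (z : C) : 0 <= normc z.
Proof. by rewrite -lecR -normc_norm normr_ge0. Qed.

Lemma normc_distC (z w : C) : normc (z - w) = normc (w - z).
Proof. by rewrite -opprB normcN. Qed.

Lemma normc_triangle (y x z : C) : normc (x - z) <= normc (x - y) + normc (y - z).
Proof. by apply: le_trans (le_normcD _ _); rewrite addrA subrK. Qed.

Lemma gt0_complex_real (e : C) : 0 < e -> exists2 r : R, 0 < r & e = r%:C%C.
Proof. by case: e => a b; rewrite ltcE /= => /andP[/eqP -> a0]; exists a. Qed.

(** The norm of the normed module of complex numbers takes complex values; this
restates convergence with real radii and the real-valued modulus. *)
Lemma cvgcP (T : Type) (F : set_system T) (f : T -> C) (z : C) : Filter F ->
  f @ F --> z <-> forall e : R, 0 < e -> \forall t \near F, normc (f t - z) < e.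
Proof.
move=> FF; rewrite cvgrPdist_lt; split=> fz e e0.
  have := fz e%:C%C; rewrite ltcR => /(_ e0); apply: filterS => t.
  by rewrite normc_norm ltcR normc_distC.
have [r r0 ->] := gt0_complex_real e0; have := fz r r0; apply: filterS => t.
by rewrite normc_norm ltcR normc_distC.
Qed.

Lemma normc_ReIm (z : C) : normc z <= `|complex.Re z| + `|complex.Im z|.
Proof.
case: z => a b /=; rewrite -[leRHS]ger0_norm ?addr_ge0// -sqrtr_sqr.
rewrite ler_sqrt ?sqr_ge0// sqrrD !real_normK ?num_real//.
by rewrite lerD2r lerDl mulrn_wge0 ?mulr_ge0.
Qed.

Lemma normc_Re (z : C) : `|complex.Re z| <= normc z.
Proof. by case: z => a b /=; rewrite -sqrtr_sqr ler_wsqrtr// lerDl sqr_ge0. Qed.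

Lemma normc_Im (z : C) : `|complex.Im z| <= normc z.
Proof. by case: z => a b /=; rewrite -sqrtr_sqr ler_wsqrtr// lerDr sqr_ge0. Qed.

Lemma normc_real (r : R) : normc (r%:C%C : C) = `|r|.
Proof. by rewrite /= expr0n/= addr0 sqrtr_sqr. Qed.

Lemma normc_conj (z : C) : normc (z^*) = normc z.
Proof. by case: z => a b /=; rewrite sqrrN. Qed.

(** Compactness of a segment gives a cluster point, and a cluster point of an
ultrafilter is a limit. *)
Lemma ultra_cvg_real (T : Type) (U : set_system T) (f : T -> R) (M : R) :
  UltraFilter U -> (forall t, `|f t| <= M) ->
  exists l : R, f @ U --> l.
Proof.
move=> UU fM.
have UP : ProperFilter (f @ U) by apply: fmap_proper_filter.
have UM : (f @ U) `[- M, M]%classic.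
  by apply: (@filterE _ U _ _) => t /=; rewrite in_itv/= -ler_norml.
have [l [_ cl]] := @segment_compact R (- M) M _ UP UM; exists l => A Al.
have [//|UA] := in_ultra_setVsetC (f @^-1` A) UU.
by have [x []] := cl (~` A) A UA Al.
Qed.

Lemma ultra_cvg_complex (T : Type) (U : set_system T) (f : T -> C) (M : R) :
  UltraFilter U -> (forall t, normc (f t) <= M) ->
  exists l : C, f @ U --> l.
Proof.
move=> UU fM.
have [a fa] := ultra_cvg_real UU (fun t => le_trans (normc_Re (f t)) (fM t)).
have [b fb] := ultra_cvg_real UU (fun t => le_trans (normc_Im (f t)) (fM t)).
exists (a +i* b)%C; apply/cvgcP => e e0.
have e2 : 0 < e / 2 by rewrite divr_gt0.
move/cvgrPdist_lt: fa => /(_ _ e2) fa; move/cvgrPdist_lt: fb => /(_ _ e2) fb.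
apply: filterS2 fa fb => t ta tb; apply: le_lt_trans (normc_ReIm _) _.
case: (f t) ta tb => x y /= ta tb.
by rewrite [ltRHS]splitr; apply: ltrD; rewrite distrC.
Qed.

Lemma cvg_conj (T : Type) (F : set_system T) (f : T -> C) (z : C) : Filter F ->
  f @ F --> z -> (fun t => (f t)^*) @ F --> z^*.
Proof.
move=> FF /cvgcP fz; apply/cvgcP => e /fz; apply: filterS => t.
by rewrite -rmorphB normc_conj.
Qed.

End ComplexLimits.

(** * Subspaces of products *)

Section SubspaceOfProduct.
Context {I : eqType} {V : topologicalType} {K : set {ptws I -> V}}.

Lemma coordinate_continuous i : continuous (fun x : set_type K => set_val x i).
Proof.
move=> x; apply: (@continuous_comp _ _ _ (set_val : set_type K -> _)
  (fun u : {ptws I -> V} => u i)).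
  exact: initial_continuous.
exact: (@proj_continuous I (fun=> V)).
Qed.

Lemma coordinate_cvgP (T : Type) (U : set_system T) (th : T -> set_type K)
    (x : set_type K) : Filter U ->
  th @ U --> x <-> forall i, (fun t => set_val (th t) i) @ U --> set_val x i.
Proof.
move=> FU; split=> [thx i|coord B [/= _ [[W oW <-] Wx WB]]].
  by apply: (@cvg_comp _ _ _ th (fun y => set_val y i)) thx _; exact: coordinate_continuous.
suff : \forall t \near U, W (set_val (th t)) by apply: filterS => t /WB.
have : nbhs (set_val x) W by rewrite nbhsE; exists W.
suff : (fun t => set_val (th t) : {ptws I -> V}) @ U --> (set_val x : {ptws I -> V}).
  by apply.
apply/cvg_sup => i; apply/cvg_image.
  by rewrite eqEsubset; split => // z _; exists (fun=> z).
move=> N Nx; have UN := coord i N Nx; exists ((fun u => u i) @^-1` N) => //.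
by rewrite image_preimage// eqEsubset; split => // z _; exists (fun=> z).
Qed.

End SubspaceOfProduct.

(** * The algebra of functions *)

Section Algebra.
Context {R : realType} {L : language} {F : structure L}.
Context (A : inv_cstar_subalgebra R F).
Local Notation C := (R[i] : numClosedFieldType).
Local Notation G := (aut F).
Local Notation inA := (cs_set A).
Implicit Types (f u : G -> C) (g h : G).

Lemma supnorm_le f (M : R) : (forall g, normc (f g) <= M) -> supnorm f <= M.
Proof.
move=> fM; apply: ge_sup; first by exists (normc (f 1%g)), 1%g.
by move=> _ [g _ <-]; exact: fM.
Qed.

Lemma le_supnorm f (M : R) g : (forall g, normc (f g) <= M) ->
  normc (f g) <= supnorm f.
Proof.
move=> fM; apply: ub_le_sup; last by exists g.
by exists M => _ [h _ <-]; exact: fM.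
Qed.

Lemma cs_bounded f : inA f -> exists M : R, forall g, normc (f g) <= M.
Proof. by move/(cs_RUCb (i := A)) => -[]. Qed.

Lemma RUCbB f u : RUCb f -> inA u -> forall eps : R, supnorm (f \- u) < eps ->
  forall g, normc (f g - u g) < eps.
Proof.
move=> [[M fM] _] /cs_bounded[N uN] eps fu g; apply: le_lt_trans fu.
apply: (@le_supnorm (f \- u) (M + N)) => {}g.
by apply: le_trans (le_normcD _ _) _; rewrite normcN lerD.
Qed.

(** The algebra is closed inside the bounded right-uniformly continuous
functions only, so a uniform limit must first be shown to be one of these. *)
Lemma cs_uniform_limit f :
  (forall e : R, 0 < e -> exists2 u, inA u & forall g, normc (f g - u g) <= e) -> inA f.
Proof.
move=> fA; apply: cs_closed; last first.
  move=> e e0; have [u Au fu] := fA (e / 2) ltac:(by rewrite divr_gt0).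
  exists u => //; apply: (@le_lt_trans _ _ (e / 2)); first exact: supnorm_le.
  by rewrite ltr_pdivrMr// ltr_pMr// ltr1n.
split.
  have [u Au fu] := fA 1 ltr01; have [M uM] := cs_bounded Au.
  exists (1 + M) => g; rewrite -[f g](subrK (u g)).
  by apply: le_trans (le_normcD _ _) _; rewrite lerD.
move=> e e0; have e4 : 0 < e / 4 by rewrite divr_gt0.
have [u Au fu] := fA _ e4; have [_ /(_ _ e4) [U U1 uU]] := cs_RUCb Au.
exists U => // g h /uU ugh.
have := normc_triangle (u g) (f g) (f h).
have := normc_triangle (u h) (u g) (f h).
have := fu g; have := fu h; rewrite (normc_distC (f h)).
by move: ugh e0; lra.
Qed.

Lemma cs_cst (c : C) : inA (fun=> c).
Proof.
have := cs_scale_subproof c (cs_one_subproof A).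
by congr (inA _); apply/funext => g /=; rewrite mulr1.
Qed.

Lemma csN f : inA f -> inA (fun g => - f g).
Proof.
move/(cs_scale_subproof (-1)).
by congr (inA _); apply/funext => g /=; rewrite mulN1r.
Qed.

Lemma csB f u : inA f -> inA u -> inA (fun g => f g - u g).
Proof. by move=> Af /csN; exact: cs_add_subproof. Qed.

Lemma csX f n : inA f -> inA (fun g => f g ^+ n).
Proof.
move=> Af; elim: n => [|n IH].
  by have := cs_cst 1; congr (inA _); apply/funext => g; rewrite expr0.
by have := cs_mul_subproof Af IH; congr (inA _); apply/funext => g; rewrite exprS.
Qed.

Lemma cs_sum (I : eqType) (s : seq I) (f : I -> G -> C) :
  (forall i, i \in s -> inA (f i)) -> inA (fun g => \sum_(i <- s) f i g).
Proof.
elim: s => [|i s IH] Af.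
  by have := cs_cst 0; congr (inA _); apply/funext => g; rewrite big_nil.
have As : inA (fun g => \sum_(j <- s) f j g).
  by apply: IH => j sj; apply: Af; rewrite inE sj orbT.
have := cs_add_subproof (Af i (mem_head _ _)) As.
by congr (inA _); apply/funext => g; rewrite big_cons.
Qed.

(** The inverse is the uniform limit of the partial sums of the geometric
series, whose n-th error term is f^n / (1 - f). *)
Lemma cs_geometric f (M : R) : inA f -> M < 1 -> (forall g, normc (f g) <= M) ->
  inA (fun g => (1 - f g)^-1).
Proof.
move=> Af M1 fM.
have M0 : 0 <= M by apply: le_trans (fM 1%g); exact: normc_ge0.
have cM0 : 0 < 1 - M by rewrite subr_gt0.
have d0 g : 1 - M <= normc (1 - f g).
  have := le_normcD (1 - f g) (f g); rewrite subrK (normc1 R).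
  by have := fM g; lra.
apply: cs_uniform_limit => e e0.
have [n Mn] : exists n, M ^+ n < e * (1 - M).
  have : (fun n => M ^+ n) @ \oo --> (0 : R) by apply: cvg_expr; rewrite ger0_norm.
  move/cvgrPdist_lt => /(_ (e * (1 - M))) [|n _ /(_ n (leqnn n))]; first exact: mulr_gt0.
  by rewrite sub0r normrN ger0_norm ?exprn_ge0// => ?; exists n.
exists (fun g => \sum_(k <- iota 0 n) f g ^+ k).
  by apply: (@cs_sum _ _ (fun k g => f g ^+ k)) => k _; exact: csX.
move=> g; have nz : 1 - f g != 0.
  apply/eqP => z0; have := d0 g; rewrite z0 (normc0 R).
  by apply/negP; rewrite -ltNge.
have -> : (1 - f g)^-1 - \sum_(k <- iota 0 n) f g ^+ k = f g ^+ n * (1 - f g)^-1.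
  apply: (mulfI nz); rewrite mulrBr mulfV// mulrCA mulfV// mulr1.
  have := subrX1 (f g) n; rewrite -(big_mkord xpredT (fun k => f g ^+ k)) /index_iota subn0 => E.
  by rewrite -[1 - f g]opprB mulNr -E opprK addrC subrK.
rewrite normcM normcV.
apply: (@le_trans _ _ (M ^+ n * (1 - M)^-1)).
  apply: ler_pM; rewrite ?invr_ge0 ?normc_ge0//.
    elim: (n) => [|k IH]; first by rewrite !expr0 (normc1 R).
    by rewrite !exprS normcM ler_pM ?normc_ge0.
  by rewrite lef_pV2 ?posrE// (lt_le_trans cM0).
by rewrite ler_pdivrMr// ltW.
Qed.

(** With B an upper bound of u, the function 1 - u / B has values in
[0, 1 - c / B], and the geometric series inverts u / B. *)
Lemma cs_inv_real (u : G -> R) (c : R) : 0 < c -> (forall g, c <= u g) ->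
  inA (fun g => (u g)%:C%C) -> inA (fun g => (u g)^-1%:C%C).
Proof.
move=> c0 cu Au; have [B uB] := cs_bounded Au.
have u0 g : 0 < u g := lt_le_trans c0 (cu g).
have uB' g : u g <= B by rewrite (le_trans (ler_norm _))// -normc_real.
have B0 : 0 < B := lt_le_trans (u0 1%g) (uB' 1%g).
have E g : 1 - (1 - (u g / B)%:C%C) = (u g / B)%:C%C :> C by rewrite opprB addrC subrK.
have : inA (fun g => (1 - (1 - (u g / B)%:C%C))^-1).
  apply: (@cs_geometric _ (1 - c / B)); last 1 first.
  - move=> g; rewrite -[1]/(1%:C%C) -rmorphB normc_real ger0_norm.
      by rewrite lerB// ler_pM2r ?invr_gt0.
    by rewrite subr_ge0 ler_pdivrMr// mul1r.
  - apply: csB; first exact: cs_cst.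
    have := cs_scale_subproof (B^-1)%:C%C Au; congr (inA _).
    by apply/funext => g /=; rewrite mulrC -rmorphM.
  - by rewrite ltrBlDr ltrDl divr_gt0.
move/(cs_scale_subproof (B^-1)%:C%C); congr (inA _); apply/funext => g /=.
rewrite E -fmorphV -rmorphM; congr (_%:C%C).
by rewrite invfM invrK mulrCA mulVf ?mulr1 ?gt_eqF.
Qed.

End Algebra.

(** * Characters *)

Section Characters.
Context {R : realType} {L : language} {F : structure L}.
Context (A : inv_cstar_subalgebra R F).
Local Notation C := (R[i] : numClosedFieldType).
Local Notation G := (aut F).
Local Notation inA := (cs_set A).
Implicit Types (f u : G -> C) (g h : G) (phi : gelfand A).

(** A character is defined on the subtype of functions in the algebra; extending
it by 0 lets it be applied to functions written as such, with membership as a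
side condition of the algebraic laws. *)
Definition cval phi f : C :=
  if pselect (inA f) is left Af then set_val phi (SigSub (mem_set Af)) else 0.

Lemma gelfandP phi : is_character (set_val phi).
Proof. exact: set_valP phi. Qed.

Lemma cvalE phi (f : set_type A) : cval phi (set_val f) = set_val phi f.
Proof.
rewrite /cval; case: pselect => [Af|]; last by case; exact: set_valP.
by congr (set_val phi _); exact: val_inj.
Qed.

Lemma cval_sub phi f (Af : f \in inA) : cval phi f = set_val phi (SigSub Af).
Proof. by rewrite -cvalE. Qed.

Lemma cval1 phi : cval phi (fun=> 1) = 1.
Proof. by rewrite -[RHS](char_one (gelfandP phi)) -cvalE. Qed.

Lemma cvalD phi f u : inA f -> inA u ->
  cval phi (fun g => f g + u g) = cval phi f + cval phi u.
Proof.
move=> /mem_set Af /mem_set Au.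
by rewrite (cval_sub _ Af) (cval_sub _ Au) -(char_add (gelfandP phi)) -cvalE.
Qed.

Lemma cvalZ phi (c : C) f : inA f -> cval phi (fun g => c * f g) = c * cval phi f.
Proof.
by move=> /mem_set Af; rewrite (cval_sub _ Af) -(char_scale (gelfandP phi)) -cvalE.
Qed.

Lemma cvalM phi f u : inA f -> inA u ->
  cval phi (fun g => f g * u g) = cval phi f * cval phi u.
Proof.
move=> /mem_set Af /mem_set Au.
by rewrite (cval_sub _ Af) (cval_sub _ Au) -(char_mul (gelfandP phi)) -cvalE.
Qed.

Lemma cvalJ phi f : inA f -> cval phi (conj_fun f) = (cval phi f)^*.
Proof.
by move=> /mem_set Af; rewrite (cval_sub _ Af) -(char_conj (gelfandP phi)) -cvalE.
Qed.

Lemma cval_cst phi (c : C) : cval phi (fun=> c) = c.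
Proof.
have := cvalZ phi c (cs_cst A 1); rewrite cval1 mulr1 => {2}<-.
by congr cval; apply/funext => g; rewrite mulr1.
Qed.

Lemma cvalB phi f u : inA f -> inA u ->
  cval phi (fun g => f g - u g) = cval phi f - cval phi u.
Proof.
move=> Af Au; rewrite cvalD//; last exact: csN.
congr (_ + _); rewrite -mulN1r -cvalZ//; congr cval.
by apply/funext => g; rewrite mulN1r.
Qed.

Lemma cval_sum phi (I : eqType) (s : seq I) (f : I -> G -> C) :
  (forall i, i \in s -> inA (f i)) ->
  cval phi (fun g => \sum_(i <- s) f i g) = \sum_(i <- s) cval phi (f i).
Proof.
elim: s => [|i s IH] Af.
  rewrite big_nil -[RHS](cval_cst phi 0); congr cval.
  by apply/funext => g; rewrite big_nil.
have As j : j \in s -> inA (f j) by move=> sj; apply: Af; rewrite inE sj orbT.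
rewrite big_cons -IH// -cvalD; [|exact/Af/mem_head|exact: cs_sum].
by congr cval; apply/funext => g; rewrite big_cons.
Qed.

Lemma cval_act g phi f : inA f ->
  cval (gelfand_act g phi) f = cval phi (Defs.lshift g^-1%g f).
Proof.
move=> /mem_set Af; rewrite (cval_sub _ Af).
by rewrite -[LHS]/(set_val phi (cs_lshift g^-1%g (SigSub Af))) -cvalE.
Qed.

Lemma gelfand_eq phi psi : (forall f, inA f -> cval phi f = cval psi f) -> phi = psi.
Proof.
move=> E; apply: val_inj; apply/funext => f.
by have := E _ (set_valP f); rewrite !cvalE.
Qed.

Lemma gelfand_cvg_cval (T : Type) (U : set_system T) (th : T -> gelfand A) phi :
  Filter U ->
  th @ U --> phi <->
  forall f, inA f -> (fun t => cval (th t) f) @ U --> (cval phi f : C).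
Proof.
move=> FU; rewrite (@coordinate_cvgP _ C _ _ U); split => [H f Af|H f].
  by have := H (SigSub (mem_set Af)); under eq_fun do rewrite -cvalE; rewrite -cvalE.
by have := H _ (set_valP f); under eq_fun do rewrite cvalE; rewrite cvalE.
Qed.

(** The squared distance from f to z, rather than the distance itself, belongs to
the algebra together with f, because it is (f - z) times its conjugate. *)
Definition sqdist f (z : C) : G -> R := fun g => normc (f g - z) ^+ 2.

Lemma sqdistE f z g : (sqdist f z g)%:C%C = (f g - z) * (f g - z)^*.
Proof. by rewrite rmorphXn/= -normc_norm normCK. Qed.

Lemma cs_sqdist f z : inA f -> inA (fun g => (sqdist f z g)%:C%C).
Proof.
move=> Af; under eq_fun do rewrite sqdistE.
have Afz : inA (fun g => f g - z) by apply: csB => //; exact: cs_cst.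
exact: cs_mul_subproof Afz (cs_conj_subproof Afz).
Qed.

Lemma cval_sqdist phi f z : inA f ->
  cval phi (fun g => (sqdist f z g)%:C%C) = (normc (cval phi f - z) ^+ 2)%:C%C.
Proof.
move=> Af; under eq_fun do rewrite sqdistE.
have Afz : inA (fun g => f g - z) by apply: csB => //; exact: cs_cst.
rewrite (@cvalM phi (fun g => f g - z) (conj_fun (fun g => f g - z)))//; last first.
  exact: cs_conj_subproof.
rewrite cvalJ// cvalB// ?cval_cst; last exact: cs_cst.
by rewrite rmorphXn/= -normc_norm normCK.
Qed.

(** Otherwise u, the sum of the squared distances from f to phi(f) over fs,
is at least d^2 everywhere, so that it is invertible in the algebra, whereas
phi sends it to 0. *)
Lemma evaluations_dense phi (fs : seq (G -> C)) (d : R) :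
  0 < d -> (forall f, f \in fs -> inA f) ->
  exists h, forall f, f \in fs -> normc (f h - cval phi f) < d.
Proof.
move=> d0 Afs; apply: contrapT => /forallNP none.
pose u g := \sum_(f <- fs) sqdist f (cval phi f) g.
have du g : d ^+ 2 <= u g.
  have /existsNP[f /not_implyP[ffs /negP]] := none g; rewrite -leNgt => df.
  rewrite /u (big_rem f)//= (@le_trans _ _ (sqdist f (cval phi f) g))//.
    by rewrite lerXn2r ?nnegrE ?normc_ge0 ?(ltW d0).
  by rewrite lerDl sumr_ge0// => i _; rewrite exprn_ge0// normc_ge0.
have Asq f : f \in fs -> inA (fun g => (sqdist f (cval phi f) g)%:C%C).
  by move=> /Afs; exact: cs_sqdist.
have uE : (fun g => (u g)%:C%C) =
    (fun g => \sum_(f <- fs) (sqdist f (cval phi f) g)%:C%C : C).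
  by apply/funext => g; rewrite rmorph_sum.
have Au : inA (fun g => (u g)%:C%C).
  by rewrite uE; exact: (cs_sum (f := fun f g => (sqdist f (cval phi f) g)%:C%C)).
have d20 : 0 < d ^+ 2 by rewrite exprn_gt0.
have Aiu := cs_inv_real d20 du Au.
have : cval phi (fun g => (u g)%:C%C * (u g)^-1%:C%C) = 1.
  rewrite -(cval1 phi); congr cval; apply/funext => g.
  by rewrite -rmorphM mulfV// gt_eqF// (lt_le_trans d20).
rewrite cvalM// uE (cval_sum phi (f := fun f g => (sqdist f (cval phi f) g)%:C%C))//.
rewrite big_seq big1 ?mul0r => [/eqP|f ffs]; first by rewrite eq_sym oner_eq0.
by rewrite cval_sqdist; [rewrite subrr (normc0 R) expr0n|exact: Afs].
Qed.

(** Characters are contractive because they are pointwise limits of evaluations;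
this bound is what makes the Gelfand space compact. *)
Lemma cval_bounded phi f (M : R) : inA f -> (forall g, normc (f g) <= M) ->
  normc (cval phi f) <= M.
Proof.
move=> Af fM; apply/ler_addgt0Pr => e e0.
have [|h /(_ f (mem_head _ _))] := @evaluations_dense phi [:: f] e e0.
  by move=> u; rewrite inE => /eqP ->.
have := normc_triangle (f h) (cval phi f) 0; rewrite !subr0 normc_distC.
by have := fM h; lra.
Qed.

(** The values at each f have a limit by boundedness, and the identities that
define characters pass to the limit. *)
Lemma ultrafilter_gelfand_cvg (T : Type) (U : set_system T) (th : T -> gelfand A) :
  UltraFilter U -> exists phi, th @ U --> phi.
Proof.
move=> UU.
have lim (f : set_type A) : exists l : C, (fun t => set_val (th t) f : C) @ U --> l.
  have [M fM] := cs_bounded (set_valP f).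
  apply: (ultra_cvg_complex (M := M) UU) => t; rewrite -cvalE.
  exact: cval_bounded (set_valP f) fM.
pose l (f : set_type A) := projT1 (cid (lim f)).
have lP (f : set_type A) : (fun t => set_val (th t) f : C) @ U --> (l f : C) := projT2 (cid (lim f)).
have char t := gelfandP (th t).
have lU (f : set_type A) z : (fun t => set_val (th t) f : C) @ U --> (z : C) -> l f = z.
  by move=> fz; apply: cvg_unique (lP f) fz; exact: norm_hausdorff.
have lchar : is_character l.
  split.
  - by apply: lU; under eq_fun do rewrite (char_one (char _)); exact: cvg_cst.
  - by move=> f u; apply: lU; under eq_fun do rewrite (char_add (char _)); exact: cvgD.
  - move=> c f; apply: lU; under eq_fun do rewrite (char_scale (char _)).
    by apply: cvgM => //; exact: cvg_cst.
  - by move=> f u; apply: lU; under eq_fun do rewrite (char_mul (char _)); exact: cvgM.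
  - by move=> f; apply: lU; under eq_fun do rewrite (char_conj (char _)); exact: cvg_conj.
by exists (SigSub (mem_set lchar)); apply/coordinate_cvgP.
Qed.

Lemma gelfand_compact : compact [set: gelfand A].
Proof.
rewrite compact_ultra => U UU _.
by have [phi] := ultrafilter_gelfand_cvg id UU; exists phi.
Qed.

Lemma evaluation_character h : is_character (fun f : set_type A => set_val f h).
Proof. by split. Qed.

Definition evaluation h : gelfand A := SigSub (mem_set (evaluation_character h)).

Lemma cval_evaluation h f : inA f -> cval (evaluation h) f = f h.
Proof. by move=> /mem_set Af; rewrite (cval_sub _ Af). Qed.

Lemma evaluationM g h : evaluation (g * h)%g = gelfand_act g (evaluation h).
Proof.
apply: gelfand_eq => f Af; rewrite cval_act// !cval_evaluation//; last exact: cs_lshift_subproof.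
by rewrite /Defs.lshift invgK.
Qed.

Lemma gelfand_act_continuous g : continuous (gelfand_act (A := A) g).
Proof.
move=> phi.
apply/(@gelfand_cvg_cval _ _ (gelfand_act g) _ (nbhs_filter phi)) => f Af.
under eq_fun do rewrite cval_act//; rewrite cval_act//.
have [+ _] := @gelfand_cvg_cval _ (nbhs phi) id phi (nbhs_filter phi).
by apply => //; exact: cs_lshift_subproof.
Qed.

End Characters.

(** * Embeddings and automorphisms *)

Section Extension.
Context {L : language} {F : structure L}.
Local Notation G := (aut F).

Lemma embedding_eq (M N : structure L) (e e' : embedding M N) : e =1 e' -> e = e'.
Proof.
case: e e' => [e eI eR] [e' eI' eR'] /= /funext ee'.
by move: eI eR; rewrite ee' => eI eR; congr Embedding; exact: Prop_irrelevance.
Qed.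

Lemma stabilizerV (S : age F) (s : G) : stabilizer S s -> stabilizer S s^-1%g.
Proof. by move=> Ss x Sx; rewrite -[X in _ = X](aut_funK s) (Ss _ Sx). Qed.

(** The restrictions of inverses to S classify the right cosets of the stabilizer
of S: this is why colorings of the copies of S are functions on these cosets. *)
Lemma restr_cosetP (S : age F) (g h : G) :
  restr g^-1%g S = restr h^-1%g S <-> exists2 s, stabilizer S s & g = (s * h)%g.
Proof.
split=> [E|[s Ss ->]]; last first.
  apply: embedding_eq => x; rewrite invgM /=; congr (aut_inv h _).
  exact: (stabilizerV Ss) (set_valP x).
exists (g * h^-1)%g; last by rewrite mulgVK.
move=> x Sx; have /(congr1 (fun e : embedding S F => e (SigSub (mem_set Sx)))) /= := E.
by move=> <-; rewrite aut_invK.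
Qed.

Lemma restr_translate (S : age F) (g : G) : exists T : age F,
  forall x, age_set S x -> age_set T (g x).
Proof.
have fT : finite_set (g @` age_set S) by apply: finite_image; exact: age_finite.
have nT : g @` age_set S !=set0.
  by have [x Sx] := age_nonempty S; exists (g x), x.
by exists (Age fT nT) => x Sx; exists x.
Qed.

Lemma age_translates (S : age F) (E : seq G) : exists T : age F,
  (forall x, age_set S x -> age_set T x) /\
  (forall g, g \in E -> forall x, age_set S x -> age_set T (g x)).
Proof.
elim: E => [|g E [T [ST ET]]]; first by exists S.
have [U SU] := restr_translate S g.
exists (ageU T U); split=> [x /ST|h]; first by left.
by rewrite inE => /orP[/eqP -> x /SU|/ET HT x /HT]; [right|left].
Qed.

(** An embedding is coded by a map between finite ordinals: the position, in an
enumeration t of T, of the image of each point of an enumeration s of S. *)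
Lemma finite_embeddings (S T : age F) :
  finite_set [set e : embedding S F | range e `<=` age_set T].
Proof.
pose F' := {classic F}.
have [s Ss] := iffLR (@finite_seqP F' (age_set S)) (age_finite S).
have [t Tt] := iffLR (@finite_seqP F' (age_set T)) (age_finite T).
have sP (i : 'I_(size s)) : age_set S (tnth (in_tuple s) i).
  by rewrite Ss /= mem_tnth.
pose pt i : S := SigSub (mem_set (sP i)).
(* The extra point of the codomain accommodates the index of a value outside t. *)
pose code (e : embedding S F) : {ffun 'I_(size s) -> 'I_(size t).+1} :=
  [ffun i => inord (index (e (pt i) : F') t)].
(* The code determines e only when its image lies in T, a fact that the second
   component records. *)
suff : finite_set ((fun e => (code e, `[< range e `<=` age_set T>])) @^-1`
    [set p : {ffun _ -> _} * bool | p.2]).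
  by apply: sub_finite_set => e eT /=; apply/asboolP.
apply: finite_preimage; last exact: finite_finset.
move=> e e'; rewrite !inE /= => /asboolP eT /asboolP e'T [ee' _].
apply: embedding_eq => x.
have xs : (set_val x : F') \in s by have := set_valP x; rewrite {1}Ss.
have /tnthP[i xi] : (set_val x : F') \in in_tuple s by [].
have -> : x = pt i by exact: val_inj.
have et : (e (pt i) : F') \in t by have /eT : range e (e (pt i)) by []; rewrite Tt.
have et' : (e' (pt i) : F') \in t by have /e'T : range e' (e' (pt i)) by []; rewrite Tt.
have := congr1 (fun c : {ffun 'I_(size s) -> 'I_(size t).+1} => val (c i)) ee'.
rewrite !ffunE /= !inordK ?ltnS ?index_size// => idx.
by rewrite -[LHS](nth_index (e (pt i) : F') et) idx nth_index.
Qed.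

Context (hF : ultrahomogeneous F).

(** An embedding is an isomorphism onto its image, which is a finite
substructure. *)
Lemma embedding_extends (T : age F) (b : embedding T F) : exists g : G, b = restr g T.
Proof.
have fT : finite_set (range b).
  apply: finite_image; have : finite_set (set_val @^-1` age_set T : set T).
    apply: finite_preimage; last exact: age_finite.
    by move=> x y _ _; exact: val_inj.
  by apply: sub_finite_set => x _; exact: set_valP.
have nT : range b !=set0 by have [x] := dom_inhabited T; exists (b x), x.
pose T' := Age fT nT.
pose b' (x : T) : T' := SigSub (mem_set (imageT b x)).
have b'inj : injective b' by move=> x y /(congr1 set_val) /= /emb_inj.
have b'int (s : symb L) (t : 'I_(arity s) -> T) : interp (b' \o t) <-> interp t.
  exact: (emb_interp b t).
have [|g gb] := hF (f := Embedding b'inj b'int).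
  rewrite /isomorphism eqEsubset; split=> // y _.
  by have [x _ xy] := set_valP y; exists x => //; apply: val_inj.
by exists g; apply: embedding_eq => x; rewrite /= gb.
Qed.

Definition ext_aut (S : age F) (e : embedding S F) : G := projT1 (cid (embedding_extends e)).

Lemma ext_autP (S : age F) (e : embedding S F) : e = restr (ext_aut e) S.
Proof. exact: projT2 (cid (embedding_extends e)). Qed.

Lemma ext_autE (S : age F) (e : embedding S F) (x : S) : ext_aut e (set_val x) = e x.
Proof. by have /(congr1 (fun e' : embedding S F => e' x)) := ext_autP e. Qed.

End Extension.

(** * Colorings and the Ramsey property on the group *)

Section Colorings.
Context {R : realType} {L : language} {F : structure L}.
Context (hF : ultrahomogeneous F).
Local Notation C := (R[i]).
Local Notation G := (aut F).

(** When F is ultrahomogeneous, these are exactly the colorings of the copies of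
S, see [color_fun_invariant] and [coloring_of_invariant]. Unlike a coloring,
such a function remains one when S is enlarged. *)
Definition stab_invariant (S : age F) (f : G -> C) : Prop :=
  forall s h, stabilizer S s -> f (s * h)%g = f h.

Lemma color_fun_invariant (S : age F) (chi : embedding S F -> C) :
  stab_invariant S (color_fun chi).
Proof.
move=> s h Ss; rewrite /color_fun.
by have -> : restr (s * h)^-1%g S = restr h^-1%g S by apply/restr_cosetP; exists s.
Qed.

Lemma coloring_of_invariant (S : age F) (f : G -> C) :
  stab_invariant S f -> finite_set (range f) ->
  exists2 chi : embedding S F -> C, finite_set (range chi) & f = color_fun chi.
Proof.
move=> Sf finf; exists (fun e => f (ext_aut hF e)^-1%g).
  by apply: sub_finite_set finf => _ [e _ <-]; exists (ext_aut hF e)^-1%g.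
apply/funext => g; rewrite /color_fun.
have := ext_autP hF (restr g^-1%g S); set k := ext_aut _ _.
move=> gk.
have /restr_cosetP[s Ss ->] : restr g^-1%g S = restr k^-1^-1%g S by rewrite invgK.
exact: Sf.
Qed.

Lemma stab_invariant_common (fs : seq (G -> C)) :
  (forall f, f \in fs -> exists S, stab_invariant S f) ->
  exists S, forall f, f \in fs -> stab_invariant S f.
Proof.
elim: fs => [|f fs IH] H.
  by have [x] := dom_inhabited F; exists (age1 x).
have [S fS] := H f (mem_head _ _).
have [T fT] : exists T, forall u, u \in fs -> stab_invariant T u.
  by apply: IH => u ufs; apply: H; rewrite inE ufs orbT.
exists (ageU S T) => u; rewrite inE => /orP[/eqP ->|/fT Tu] s h Ss.
  by apply: fS => x Sx; apply: Ss; left.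
by apply: Tu => x Sx; apply: Ss; right.
Qed.

(** Enlarging the substructures gives the functions a common S, and then T is
taken to contain S and its images under the inverses of E. A copy of T is the
restriction of some automorphism; its inverse is h, because f(h) and the
f(g h) are the colors of copies of S inside that copy of T. *)
Lemma ramsey_almost_invariant (close : C -> C -> Prop) (Fam : set (G -> C))
    (fs : seq (G -> C)) (E : seq G) :
  ramsey_rel close Fam ->
  (forall f, f \in fs -> [/\ Fam f, finite_set (range f) & exists S, stab_invariant S f]) ->
  exists h, forall f g, f \in fs -> g \in E -> close (f (g * h)%g) (f h).
Proof.
move=> ram fsP.
have [S fS] : exists S, forall f, f \in fs -> stab_invariant S f.
  by apply: stab_invariant_common => f /fsP[].
have [T [ST ET]] := age_translates S [seq g^-1%g | g <- E].
pose Cs : set (embedding S F -> C) :=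
  [set chi | (color_fun chi : G -> C) \in fs /\ finite_set (range chi)].
have finCs : finite_set Cs.
  have : finite_set ((@color_fun R L F S) @^-1` [set` fs]).
    apply: finite_preimage; last exact: finite_seq.
    move=> chi chi' _ _ E'; apply/funext => e; rewrite (ext_autP hF e).
    by have := congr1 (fun f => f (ext_aut hF e)^-1%g) E'; rewrite /color_fun invgK.
  by apply: sub_finite_set => chi [].
have [b bP] := ram S T Cs finCs (fun chi H => conj H.2 (let: And3 f _ _ := fsP _ H.1 in f)).
exists (ext_aut hF b)^-1%g => f g ffs gE.
have [_ finf _] := fsP f ffs.
have [chi finchi fchi] := coloring_of_invariant (fS f ffs) finf.
rewrite fchi; apply: bP; first by split; rewrite -?fchi.
- move=> _ [x _ <-]; rewrite invgM invgK.
  have Tx : age_set T (g^-1%g (set_val x)).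
    by apply: ET (set_valP x); rewrite map_f.
  exists (SigSub (mem_set Tx)) => //.
  by rewrite -(ext_autE hF b).
- move=> _ [x _ <-]; rewrite invgK.
  exists (SigSub (mem_set (ST _ (set_valP x)))) => //.
  by rewrite -(ext_autE hF b).
Qed.

(** Only finitely many embeddings of S have image in T. Each of them is the
restriction of an automorphism, and the inverses of these automorphisms form
the finite set to which the hypothesis is applied; the copy of T is its image
under the inverse of h. *)
Lemma ramsey_witness (close : C -> C -> Prop) (S T : age F) (Cs : set (embedding S F -> C)) :
  (forall E : seq G, exists h, forall chi, Cs chi -> {in E &, forall g g',
     close (color_fun chi (g * h)%g) (color_fun chi (g' * h)%g)}) ->
  exists b : embedding T F, forall chi, Cs chi ->
    forall e e' : embedding S F, range e `<=` range b ->
      range e' `<=` range b -> close (chi e) (chi e').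
Proof.
move=> H.
have [E EP] : exists E : seq G, [set (ext_aut hF e)^-1%g | e in
    [set e : embedding S F | range e `<=` age_set T]] = [set` E].
  by apply/finite_seqP; apply: finite_image; exact: finite_embeddings.
have [h hP] := H E; exists (restr h^-1%g T) => chi Cchi.
suff K (e : embedding S F) : range e `<=` range (restr h^-1%g T) ->
    exists2 g, g \in E & chi e = color_fun chi (g * h)%g.
  by move=> e e' /K[g gE ->] /K[g' g'E ->]; exact: hP.
move=> eb.
have inj : injective (h \o e) by apply: inj_comp (@emb_inj _ _ _ e); exact: can_inj (aut_funK h).
have int (s : symb L) (t : 'I_(arity s) -> S) : @interp L F s ((h \o e) \o t) <-> interp t.
  by apply: iff_trans (emb_interp e t); exact: (aut_interp h (e \o t)).
pose e1 : embedding S F := Embedding inj int.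
have e1T : range e1 `<=` age_set T.
  move=> _ [x _ <-] /=; have [y _ <-] : range (restr h^-1%g T) (e x) by apply: eb; exists x.
  by rewrite /= aut_invK; exact: set_valP.
exists (ext_aut hF e1)^-1%g.
  have : [set` E] (ext_aut hF e1)^-1%g by rewrite -EP; exists e1.
  by [].
rewrite /color_fun invgM invgK; congr chi; apply: embedding_eq => x /=.
have := ext_autE hF e1 x; rewrite /= => ->.
by rewrite aut_funK.
Qed.

End Colorings.

(** * Finite-valued functions and approximation *)

(** The form in which compactness is used: either finitely many of the sets have
no common point, or all of them belong to one ultrafilter. *)
Lemma ultrafilter_of_fip (T : Type) (I : eqType) (P : I -> Prop) (D : I -> set T) :
  (forall s : seq I, (forall i, i \in s -> P i) -> exists t, forall i, i \in s -> D i t) ->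
  exists2 U : set_system T, UltraFilter U & forall i, P i -> U (D i).
Proof.
move=> fip.
pose B := [set s : seq I | forall i, i \in s -> P i].
pose N (s : seq I) := [set t | forall i, i \in s -> D i t].
have NF : ProperFilter (filter_from B N).
  apply: filter_from_proper; last by move=> s /fip[t Nt]; exists t.
  apply: filter_from_filter; first by exists [::].
  move=> s s' Bs Bs'; exists (s ++ s').
    by move=> i; rewrite mem_cat => /orP[/Bs|/Bs'].
  by move=> t Nt; split=> i si; apply: Nt; rewrite mem_cat si ?orbT.
have [U [UU NU]] := ultraFilterLemma NF; exists U => // i Pi.
apply: NU; exists [:: i]; first by move=> j; rewrite inE => /eqP ->.
by move=> t; apply; exact: mem_head.
Qed.

Lemma seq_pos_lower_bound (R : realType) (I : eqType) (s : seq I) (e : I -> R) :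
  (forall i, i \in s -> 0 < e i) -> exists2 d : R, 0 < d & forall i, i \in s -> d <= e i.
Proof.
elim: s => [|i s IH] es; first by exists 1.
have [|d d0 ds] := IH; first by move=> j js; apply: es; rewrite inE js orbT.
exists (Num.min d (e i)); first by rewrite lt_min d0 es ?mem_head.
by move=> j; rewrite inE ge_min => /orP[/eqP ->|/ds ->//]; rewrite lexx orbT.
Qed.

Section FiniteRange.
Context {R : realType} {L : language} {F : structure L}.
Local Notation C := (R[i] : numClosedFieldType).
Local Notation G := (aut F).
Implicit Types (f : G -> C).

Lemma finite_separation (V : set C) : finite_set V ->
  exists2 d : R, 0 < d & forall z w, V z -> V w -> normc (z - w) < d -> z = w.
Proof.
move=> /finite_seqP[s ->].
have [|d d0 dP] := @seq_pos_lower_bound R _ [seq p <- [seq (z, w) | z <- s, w <- s] | p.1 != p.2]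
    (fun p => normc (p.1 - p.2)).
  move=> [z w]; rewrite mem_filter /= => /andP[zw _].
  rewrite lt_neqAle normc_ge0 andbT eq_sym.
  by apply: contra zw => /eqP /eq0_normc /eqP; rewrite subr_eq0.
exists d => // z w /= zs ws zwd; apply/eqP; apply: contraLR zwd => zw.
by rewrite -leNgt; apply: (dP (z, w)); rewrite mem_filter /= zw allpairs_f.
Qed.

Lemma finite_range_bounded f : finite_set (range f) ->
  exists M : R, forall g, normc (f g) <= M.
Proof.
move=> /finite_seqP[s sE]; exists (\sum_(z <- s) normc z) => g.
have gs : f g \in s by have : range f (f g) by []; rewrite sE.
by rewrite (big_rem _ gs)/= lerDl sumr_ge0// => z _; exact: normc_ge0.
Qed.

Lemma stab_invariant_RUCb f (S : age F) :
  finite_set (range f) -> stab_invariant S f -> RUCb f.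
Proof.
move=> /finite_range_bounded[M fM] Sf; split; first by exists M.
move=> e e0; exists (stabilizer S).
  by exists S => s Ss; rewrite mul1g.
by move=> g h Ss; have := Sf _ h Ss; rewrite mulgVK => ->; rewrite subrr (normc0 R).
Qed.

(** Stabilizers of finite substructures form a basis of neighborhoods of 1, and
the quotient of s h by h is s. *)
Lemma RUCb_almost_stab_invariant f (e : R) : RUCb f -> 0 < e ->
  exists S : age F, forall s h, stabilizer S s -> normc (f (s * h)%g - f h) < e.
Proof.
move=> [_ fU] /fU[U [S SU] Uf]; exists S => s h Ss; apply: Uf.
by rewrite mulgK -[s]mul1g; exact: SU.
Qed.

(** With finitely many values, being close enough means being equal. *)
Lemma RUCb_stab_invariant f : RUCb f -> finite_set (range f) ->
  exists S, stab_invariant S f.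
Proof.
move=> fU /finite_separation[d d0 dP].
have [S SP] := RUCb_almost_stab_invariant fU d0.
by exists S => s h /SP/dP; apply.
Qed.

(** Total boundedness by compactness: if no finite set of centers worked, f would
converge along an ultrafilter that stays at distance d from every point, the
limit included. *)
Lemma bounded_net f (M d : R) : 0 < d -> (forall g, normc (f g) <= M) ->
  exists s : seq C, forall g, exists2 z, z \in s & normc (f g - z) < d.
Proof.
move=> d0 fM; apply: contrapT => /forallNP none.
have [|U UU UP] := @ultrafilter_of_fip G C (fun=> True) (fun z => [set g | d <= normc (f g - z)]).
  move=> s _; have /existsNP[g gP] := none s; exists g => z zs /=.
  by rewrite leNgt; apply/negP => fz; apply: gP; exists z.
have [l /cvgcP/(_ _ d0) fl] := ultra_cvg_complex UU fM.
have := UP l I => /(filterI fl) /filter_ex [g []] /= fl1.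
by rewrite leNgt fl1.
Qed.

(** Evaluate f at a representative of each coset of a stabilizer on whose cosets
f varies by less than d / 2, then round to a finite net of mesh d / 2. *)
Lemma finite_coloring_approximation (hF : ultrahomogeneous F) f (d : R) :
  RUCb f -> 0 < d ->
  exists c : G -> C, [/\ finite_set (range c), exists S, stab_invariant S c
    & forall g, normc (c g - f g) <= d].
Proof.
move=> fU d0; have d2 : 0 < d / 2 by rewrite divr_gt0.
have [S SP] := RUCb_almost_stab_invariant fU d2.
have [[M fM] _] := fU; have [s sP] := bounded_net d2 fM.
pose round w := nth 0 s (find (fun z => normc (w - z) < d / 2) s).
have hasP g : has (fun z => normc (f g - z) < d / 2) s.
  by apply/hasP; have [z zs fz] := sP g; exists z.
pose rep g := (ext_aut hF (restr g^-1%g S))^-1%g.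
have repP g : exists2 s, stabilizer S s & rep g = (s * g)%g.
  by apply/restr_cosetP; rewrite /rep invgK -ext_autP.
exists (fun g => round (f (rep g))); split.
- apply: (@sub_finite_set _ _ [set` s]); last exact: finite_seq.
  by move=> _ [g _ <-] /=; rewrite mem_nth// -has_find.
- exists S => t h St; congr (round (f _)); rewrite /rep.
  by have -> : restr (t * h)^-1%g S = restr h^-1%g S by apply/restr_cosetP; exists t.
- move=> g; apply: le_trans (normc_triangle (f (rep g)) _ _) _.
  rewrite [leRHS]splitr lerD ?ltW//.
    by rewrite normc_distC; exact: (nth_find 0 (hasP (rep g))).
  by have [t St ->] := repP g; exact: SP.
Qed.

End FiniteRange.

(** * Fixed points and almost invariant evaluations *)

Section FixedPoints.
Context {R : realType} {L : language} {F : structure L}.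
Context (A : inv_cstar_subalgebra R F).
Context (hF : ultrahomogeneous F).
Local Notation C := (R[i] : numClosedFieldType).
Local Notation G := (aut F).
Local Notation inA := (cs_set A).
Implicit Types (f : G -> C).

Lemma evaluation_cvg_cval (U : set_system G) (phi : gelfand A) : UltraFilter U ->
  evaluation A @ U --> phi ->
  forall f, inA f -> (fun h => f h) @ U --> (cval phi f : C).
Proof.
move=> UU /gelfand_cvg_cval evphi f Af.
by have := evphi f Af; under eq_fun do rewrite cval_evaluation//.
Qed.

(** The sets of h where |f(g h) - f(h)| < e have the finite intersection
property. A limit of the evaluations along an ultrafilter containing them is
fixed. *)
Lemma fixed_point_of_almost_invariant :
  (forall (fs : seq (G -> C)) (E : seq G) (e : R), 0 < e ->
    (forall f, f \in fs -> inA f) ->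
    exists h, forall f g, f \in fs -> g \in E -> normc (f (g * h)%g - f h) < e) ->
  has_fixed_point (gelfand_act (A := A)).
Proof.
move=> H.
have [|U UU UP] := @ultrafilter_of_fip G ((G -> C) * G * R)%type
    (fun i => inA i.1.1 /\ 0 < i.2)
    (fun i => [set h | normc (i.1.1 (i.1.2 * h)%g - i.1.1 h) < i.2]).
  move=> s sP.
  have [|e e0 es] := @seq_pos_lower_bound R _ s snd; first by move=> i /sP[].
  have [|h hP] := H [seq i.1.1 | i <- s] [seq i.1.2 | i <- s] e e0.
    by move=> f /mapP[i /sP[Ai _] ->].
  exists h => i si /=; apply: lt_le_trans (es _ si).
  by apply: hP; [apply: (map_f (fun i => i.1.1))|apply: (map_f (fun i => i.1.2))].
have [phi evphi] := ultrafilter_gelfand_cvg (evaluation A) UU.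
have lim := evaluation_cvg_cval UU evphi.
exists phi => g; apply: gelfand_eq => f Af; rewrite cval_act//.
apply/eqP; rewrite -subr_eq0; apply/eqP/eq0_normc/eqP.
rewrite eq_le normc_ge0 andbT; apply/ler_addgt0Pr => e e0; rewrite add0r.
have e3 : 0 < e / 3 by rewrite divr_gt0.
have Agf : inA (Defs.lshift g^-1%g f) by exact: cs_lshift_subproof.
have /cvgcP/(_ _ e3) l1 := lim _ Agf; have /cvgcP/(_ _ e3) l2 := lim _ Af.
have l3 := UP (f, g, e / 3) (conj Af e3).
have [h [[/= + +] +]] := filter_ex (filterI (filterI l1 l2) l3).
rewrite /Defs.lshift invgK.
set a := cval _ _; set b := cval _ _.
have := normc_triangle (f (g * h)%g) a b; have := normc_triangle (f h) (f (g * h)%g) b.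
by rewrite (normc_distC a (f (g * h)%g)); lra.
Qed.

(** The common form of the passages from a Ramsey property to a fixed point: the
functions of the algebra are replaced by finite colorings of a family Fam, to
which the Ramsey property applies up to a controlled error. *)
Lemma fixed_point_of_ramsey :
  (forall e : R, 0 < e -> exists (close : C -> C -> Prop) (Fam : set (G -> C)),
    [/\ ramsey_rel close Fam, forall z w, close z w -> normc (z - w) <= e
    & forall f, inA f -> exists c, [/\ Fam c, finite_set (range c),
        exists S, stab_invariant S c & forall g, normc (c g - f g) <= e]]) ->
  has_fixed_point (gelfand_act (A := A)).
Proof.
move=> H; apply: fixed_point_of_almost_invariant => fs E e e0 Afs.
have e4 : 0 < e / 4 by rewrite divr_gt0.
have [close [Fam [ram closeP FamP]]] := H _ e4.
have /choice[c cP] : forall f, exists c, inA f -> [/\ Fam c, finite_set (range c),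
        exists S, stab_invariant S c & forall g, normc (c g - f g) <= e / 4].
  by move=> f; have [/FamP[c cP]|nAf] := pselect (inA f); [exists c|exists f].
have [|h hP] := ramsey_almost_invariant hF (fs := [seq c f | f <- fs]) E ram.
  by move=> u /mapP[f /Afs/cP[? ? ? _] ->].
exists h => f g ffs gE; have [_ _ _ cf] := cP _ (Afs _ ffs).
have /closeP := hP _ _ (map_f c ffs) gE.
have := cf (g * h)%g; rewrite normc_distC.
have := normc_triangle (c f (g * h)%g) (f (g * h)%g) (f h).
have := normc_triangle (c f h) (c f (g * h)%g) (f h).
by have := cf h; lra.
Qed.

Lemma ramsey_upto_fixed_point :
  (forall e : R, 0 < e -> ramsey_upto (2 * e) (thicken A e)) ->
  has_fixed_point (gelfand_act (A := A)).
Proof.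
move=> ii; apply: fixed_point_of_ramsey => e e0.
have e2 : 0 < e / 2 by rewrite divr_gt0.
exists (fun z w => normc (z - w) < 2 * (e / 2)), (thicken A (e / 2)).
split=> [|z w /ltW|f Af]; first exact: ii.
  by rewrite mulrC divfK.
have e4 : 0 < e / 4 by rewrite divr_gt0.
have [c [cfin [S Sc] cf]] := finite_coloring_approximation hF (cs_RUCb Af) e4.
exists c; split => //; last by move=> g; apply: le_trans (cf g) _; lra.
- split; first exact: stab_invariant_RUCb cfin Sc.
  by exists f => //; apply: le_lt_trans (supnorm_le cf) _; lra.
- by exists S.
Qed.

Lemma dense_ramsey_fixed_point : finite_colorings_dense A -> ramsey A ->
  has_fixed_point (gelfand_act (A := A)).
Proof.
move=> dense ram; apply: fixed_point_of_ramsey => e e0.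
exists eq, A; split=> // [z w ->|f Af]; first by rewrite subrr (normc0 R) ltW.
have [c [[S [chi [chifin cE]]] Ac fc]] := dense f Af e e0.
exists c; split => //.
- have : finite_set (range chi) by [].
  apply: sub_finite_set => _ [g _ <-]; rewrite cE.
  by exists (restr g^-1%g S).
- by exists S; rewrite cE; exact: color_fun_invariant.
- by move=> g; rewrite normc_distC ltW// (RUCbB (cs_RUCb Af) Ac fc).
Qed.

(** By density, some evaluation h is close to phi on all the translates of the
functions of fs by the elements of E, and phi takes the same value on each
translate. *)
Lemma almost_constant_at (phi : gelfand A) (fs : seq (G -> C)) (E : seq G) (d : R) :
  0 < d -> (forall f, f \in fs -> inA f /\ forall g, cval phi (Defs.lshift g f) = cval phi f) ->
  exists h, forall f g, f \in fs -> g \in E -> normc (f (g * h)%g - cval phi f) < d.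
Proof.
move=> d0 fsP.
have [|h hP] := evaluations_dense phi (fs := [seq Defs.lshift g^-1%g f | f <- fs, g <- E]) d0.
  by move=> _ /allpairsP[[f g] [/= /fsP[Af _] _ ->]]; exact: cs_lshift_subproof.
exists h => f g ffs gE; have [_ fix_f] := fsP f ffs.
have := hP _ (allpairs_f (fun f g => Defs.lshift g^-1%g f) ffs gE).
by rewrite fix_f /Defs.lshift invgK.
Qed.

(** Each coloring is strictly e-close to some a in the algebra. The translates
of a at a suitable h are nearly phi(a), so those of the coloring are within e
of phi(a), and any two of them within 2 e of each other. *)
Lemma fixed_point_ramsey_upto : has_fixed_point (gelfand_act (A := A)) ->
  forall e : R, 0 < e -> ramsey_upto (2 * e) (thicken A e).
Proof.
move=> [phi phiP] e e0 S T Cs /finite_seqP[cs ->] csP;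
  apply: (ramsey_witness hF (close := fun z w => normc (z - w) < 2 * e)) => E.
have /choice[a aP] : forall chi : embedding S F -> C, exists a : G -> C, chi \in cs ->
    inA a /\ supnorm (color_fun chi \- a) < e.
  move=> chi; have [/csP[_ [_ [a ? ?]]]|_] := boolP (chi \in cs); last by exists (fun=> 0).
  by exists a.
(* The strict inequality leaves a margin for the error of the density
   argument. *)
have [|d d0 ds] := @seq_pos_lower_bound R _ cs (fun chi => e - supnorm (color_fun chi \- a chi)).
  by move=> chi /aP[_]; rewrite subr_gt0.
have [|h hP] := @almost_constant_at phi [seq a chi | chi <- cs] E d d0.
  move=> _ /mapP[chi /aP[Aa _] ->]; split => // g.
  by rewrite -{2}(phiP g^-1%g) cval_act// invgK.
exists h => chi chics g g' gE g'E.
have [Aa _] := aP _ chics; have [_ [chiU _]] := csP _ chics.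
have [[M chiM] _] := chiU; have [N aN] := cs_bounded Aa.
have sup k : normc (color_fun chi k - a chi k) <= supnorm (color_fun chi \- a chi).
  apply: (@le_supnorm _ _ _ (color_fun chi \- a chi) (M + N)) => {}k.
  by apply: le_trans (le_normcD _ _) _; rewrite normcN lerD.
have close k : k \in E -> normc (color_fun chi (k * h)%g - cval phi (a chi)) < e.
  move=> kE; have := hP (a chi) k (map_f a chics) kE.
  have := normc_triangle (a chi (k * h)%g) (color_fun chi (k * h)%g) (cval phi (a chi)).
  by have := ds _ chics; have := sup (k * h)%g; lra.
have := close g gE; have := close g' g'E; rewrite normc_distC.
have := normc_triangle (cval phi (a chi)) (color_fun chi (g * h)%g) (color_fun chi (g' * h)%g).
by lra.
Qed.

End FixedPoints.

(** * Clopen sets are cut out by functions of the algebra *)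

Section Clopen.
Context {R : realType} {L : language} {F : structure L}.
Context (A : inv_cstar_subalgebra R F).
Local Notation C := (R[i] : numClosedFieldType).
Local Notation G := (aut F).
Local Notation inA := (cs_set A).
Implicit Types (f : G -> C) (r : G -> R) (phi : gelfand A) (K : set (gelfand A)).

Definition real_in r := inA (fun g => (r g)%:C%C).

Lemma real_in_cst (c : R) : real_in (fun=> c).
Proof. exact: cs_cst. Qed.

Lemma real_inX r n : real_in r -> real_in (fun g => r g ^+ n).
Proof.
move=> /(csX n); congr (inA _); apply/funext => g.
by rewrite rmorphXn.
Qed.

Lemma real_inB r r' : real_in r -> real_in r' -> real_in (fun g => r g - r' g).
Proof.
move=> Ar /(csB Ar); congr (inA _); apply/funext => g.
by rewrite rmorphB.
Qed.

Lemma real_inM r r' : real_in r -> real_in r' -> real_in (fun g => r g * r' g).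
Proof.
move=> Ar /(cs_mul_subproof Ar); congr (inA _); apply/funext => g /=.
by rewrite -rmorphM.
Qed.

Lemma real_in_prod (s : seq (G -> R)) (v : (G -> R) -> G -> R) :
  (forall r, r \in s -> real_in (v r)) -> real_in (fun g => \prod_(r <- s) v r g).
Proof.
elim: s => [|r s IH] Av.
  by have := real_in_cst 1; congr real_in; apply/funext => g; rewrite big_nil.
have : real_in (fun g => v r g * \prod_(r <- s) v r g).
  by apply: real_inM; [exact/Av/mem_head|apply: IH => r' sr'; apply: Av; rewrite inE sr' orbT].
by congr real_in; apply/funext => g; rewrite big_cons.
Qed.

Lemma real_in_sum (I : eqType) (s : seq I) (v : I -> G -> R) :
  (forall i, i \in s -> real_in (v i)) -> real_in (fun g => \sum_(i <- s) v i g).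
Proof.
move=> /(cs_sum (f := fun i g => (v i g)%:C%C)); congr (inA _).
by apply/funext => g; rewrite rmorph_sum.
Qed.

(** As n grows, r^n / (1 + r^n) tends uniformly to 0 where r <= 1/2 and to 1 where
r >= 2, with values in [0, 1] throughout. *)
Definition cutoff (n : nat) (r : G -> R) : G -> R := fun g => 1 - (1 + r g ^+ n)^-1.

Lemma real_in_cutoff n r : (forall g, 0 <= r g) -> real_in r -> real_in (cutoff n r).
Proof.
move=> r0 Ar; apply: real_inB; first exact: real_in_cst.
apply: (@cs_inv_real _ _ _ _ (fun g => 1 + r g ^+ n) 1) => // [g|].
  by rewrite lerDl exprn_ge0.
have : real_in (fun g => 1 - (0 - r g ^+ n)).
  by apply: real_inB (real_in_cst 1) (real_inB (real_in_cst 0) (real_inX n Ar)).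
by congr real_in; apply/funext => g; rewrite sub0r opprK.
Qed.

Lemma cutoff_ge0 n r g : 0 <= r g -> 0 <= cutoff n r g.
Proof.
by move=> r0; rewrite subr_ge0 invf_le1 ?ltr_wpDr ?exprn_ge0// lerDl exprn_ge0.
Qed.

Lemma cutoff_le1 n r g : 0 <= r g -> cutoff n r g <= 1.
Proof. by move=> r0; rewrite gerBl invr_ge0 addr_ge0// exprn_ge0. Qed.

Lemma cutoff_small n r g : 0 <= r g -> r g <= 2^-1 -> cutoff n r g <= 2^-1 ^+ n.
Proof.
move=> r0 r2; have x0 : 0 <= r g ^+ n by rewrite exprn_ge0.
apply: (@le_trans _ _ (r g ^+ n)); last by rewrite lerXn2r ?nnegrE.
rewrite /cutoff; move: x0; set x := r g ^+ n => x0.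
have x1 : 0 < 1 + x by rewrite ltr_pwDl.
have -> : 1 - (1 + x)^-1 = x / (1 + x) by field; rewrite gt_eqF.
by rewrite ler_pdivrMr// ler_peMr// lerDl.
Qed.

Lemma cutoff_large n r g : 2 <= r g -> 1 - 2^-1 ^+ n <= cutoff n r g.
Proof.
move=> r2; rewrite lerB// exprVn lef_pV2 ?posrE ?exprn_gt0//; last first.
  by rewrite ltr_wpDr// exprn_ge0// (le_trans _ r2).
apply: (@le_trans _ _ (r g ^+ n)); last by rewrite lerDr.
by rewrite lerXn2r ?nnegrE// (le_trans _ r2).
Qed.

(** Bernoulli's inequality for unequal factors. *)
Lemma prod_ge_sub (s : seq (G -> R)) (v : (G -> R) -> R) (q : R) : 0 <= q <= 1 ->
  (forall r, r \in s -> 1 - q <= v r <= 1) ->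
  1 - (size s)%:R * q <= \prod_(r <- s) v r <= 1.
Proof.
move=> /andP[q0 q1]; elim: s => [|r s IH] vs.
  by rewrite big_nil mul0r subr0 lexx.
have /andP[p1 p2] := IH (fun r' sr' => vs r' (mem_behead (s := r :: s) sr')).
have /andP[v1 v2] := vs r (mem_head _ _).
have p0 : 0 <= \prod_(r <- s) v r.
  rewrite big_seq prodr_ge0// => r' sr'; have /andP[+ _] := vs r' (mem_behead (s := r :: s) sr').
  by apply: le_trans; rewrite subr_ge0.
rewrite big_cons /= -natr1; move: p0 p1 p2 v1 v2; set p := \prod_(_ <- _) _.
by move: (_%:R : R) => m; nra.
Qed.

Definition indicator K : G -> C := fun h => (`[< K (evaluation A h) >])%:R.

(** Were phi in the closure of the evaluations outside K, an ultrafilter of such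
evaluations would converge to a point of the open set K. So finitely many
functions of the algebra keep phi away from them, and r is a multiple of the
sum of their squared distances to their values at phi. *)
Lemma separate_from_point K phi : open K -> K phi ->
  exists r, [/\ real_in r, forall g, 0 <= r g,
    forall g, ~ K (evaluation A g) -> 2 <= r g & cval phi (fun g => (r g)%:C%C) = 0].
Proof.
move=> oK Kphi.
have [s sP sK] : exists2 s : seq ((G -> C) * R), (forall i, i \in s -> inA i.1 /\ 0 < i.2) &
    forall g, ~ K (evaluation A g) -> exists2 i, i \in s & i.2 <= normc (i.1 g - cval phi i.1).
  apply: contrapT => none.
  have [|U UU UP] := @ultrafilter_of_fip G ((G -> C) * R)%type
      (fun i => inA i.1 /\ 0 < i.2)
      (fun i => [set g | ~ K (evaluation A g) /\ normc (i.1 g - cval phi i.1) < i.2]).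
    move=> s sP; apply: contrapT => /forallNP nog; apply: none; exists s => // g nK.
    have /existsNP[i /not_implyP[si ni]] := nog g; exists i => //.
    by rewrite leNgt; apply/negP => lt; apply: ni.
  have evphi : evaluation A @ U --> phi.
    apply/gelfand_cvg_cval => f Af; apply/cvgcP => e e0.
    apply: filterS (UP (f, e) (conj Af e0)) => g [_ /=].
    by rewrite cval_evaluation.
  have UK : U (evaluation A @^-1` K) by apply: evphi; rewrite nbhsE; exists K.
  have [g [Kg [nKg _]]] := filter_ex (filterI UK (UP (fun=> 1, 1) (conj (cs_cst A 1) ltr01))).
  exact: nKg.
have [|e e0 es] := @seq_pos_lower_bound R _ s snd; first by move=> i /sP[].
pose c := 2 / e ^+ 2.
have e20 : 0 < e ^+ 2 by rewrite exprn_gt0.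
have c0 : 0 < c by rewrite divr_gt0.
have Asq i : i \in s -> real_in (sqdist i.1 (cval phi i.1)).
  by move=> /sP[Ai _]; exact: cs_sqdist.
exists (fun g => c * \sum_(i <- s) sqdist i.1 (cval phi i.1) g); split.
- by apply: real_inM (real_in_cst c) _; exact: real_in_sum.
- move=> g; rewrite mulr_ge0 ?(ltW c0)// sumr_ge0// => i _.
  by rewrite exprn_ge0// normc_ge0.
- move=> g /sK[i si iP]; rewrite mulrAC ler_pdivlMr// ler_pM2l//.
  rewrite (big_rem i)//= (@le_trans _ _ (sqdist i.1 (cval phi i.1) g))//.
    rewrite lerXn2r ?nnegrE ?normc_ge0 ?(ltW e0)//.
    by apply: le_trans iP; exact: es.
  by rewrite lerDl sumr_ge0// => j _; rewrite exprn_ge0// normc_ge0.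
- have -> : (fun g => (c * \sum_(i <- s) sqdist i.1 (cval phi i.1) g)%:C%C) =
      (fun g => c%:C%C * \sum_(i <- s) (sqdist i.1 (cval phi i.1) g)%:C%C : C).
    by apply/funext => g; rewrite rmorphM rmorph_sum.
  pose v (i : (G -> C) * R) g : C := (sqdist i.1 (cval phi i.1) g)%:C%C.
  rewrite cvalZ; last exact: (cs_sum (f := v)).
  rewrite (cval_sum phi (f := v))// big_seq big1 ?mulr0// => i /sP[Ai _].
  by rewrite /v cval_sqdist// subrr (normc0 R) expr0n.
Qed.

(** A compactness argument on top of [separate_from_point]. If no finite family
sufficed, evaluations in K at which every admissible r is at least 1/2 would
accumulate at some phi; it lies in K, which is closed, but an admissible r
vanishes at phi. *)
Lemma separate_from_clopen K : clopen K ->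
  exists s : seq (G -> R), (forall r, r \in s ->
      [/\ real_in r, forall g, 0 <= r g & forall g, ~ K (evaluation A g) -> 2 <= r g]) /\
    forall g, K (evaluation A g) -> exists2 r, r \in s & r g < 2^-1.
Proof.
move=> [oK cK]; apply: contrapT => /forallNP none.
pose P r := [/\ real_in r, forall g, 0 <= r g & forall g, ~ K (evaluation A g) -> 2 <= r g].
have [|U UU UP] := @ultrafilter_of_fip G (G -> R) P
    (fun r => [set g | K (evaluation A g) /\ 2^-1 <= r g]).
  move=> s sP; apply: contrapT => /forallNP nog; apply: (none s); split => // g Kg.
  have /existsNP[r /not_implyP[sr nr]] := nog g; exists r => //.
  by rewrite ltNge; apply/negP => le; apply: nr.
have [phi evphi] := ultrafilter_gelfand_cvg (evaluation A) UU.
have Kphi : K phi.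
  apply: (@closed_cvg _ _ U _ (evaluation A) K) => //.
  apply: filterS (UP (fun=> 2) _) => [g []//|].
  by split; [exact: real_in_cst|move=> _; exact: ler0n|].
have [r [Ar r0 rK phir]] := separate_from_point oK Kphi.
have /cvgcP := evaluation_cvg_cval UU evphi Ar.
have h0 : (0 : R) < 2^-1 by [].
move=> /(_ _ h0) l1; have [g /= [+ [_]]] := filter_ex (filterI l1 (UP r (And3 Ar r0 rK))).
by rewrite phir subr0 normc_real ger0_norm// ltNge => /negP.
Qed.

(** The product of the cutoffs of a separating family is small on K, where one
factor is, and close to 1 outside K, where all factors are. Hence it tends
uniformly to the indicator of the complement of K. *)
Lemma indicator_in K : clopen K -> inA (indicator K).
Proof.
move=> /separate_from_clopen[s [sP sK]].
have : inA (fun g => 1 - indicator (~` K) g); last first.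
  congr (inA _); apply/funext => g; rewrite /indicator.
  have [Kg|nKg] := pselect (K (evaluation A g)).
    have -> : `[< (~` K) (evaluation A g) >] = false by apply: asboolF; exact.
    by rewrite asboolT// subr0.
  by rewrite asboolT// subrr asboolF.
apply: csB; first exact: cs_cst.
apply: cs_uniform_limit => e e0.
(* One bound for both cases: 2^-n on K and (size s) 2^-n outside. *)
have [n nP] : exists n : nat, (size s).+1%:R * 2^-1 ^+ n <= e :> R.
  have : (fun n => 2^-1 ^+ n) @ \oo --> (0 : R).
    by apply: cvg_expr; rewrite ger0_norm// invf_lt1// ltr1n.
  have d0 : 0 < e / (size s).+1%:R by rewrite divr_gt0.
  move/cvgrPdist_lt => /(_ _ d0) [n _ /(_ n (leqnn n))].
  rewrite sub0r normrN ger0_norm ?exprn_ge0// => lt; exists n.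
  by rewrite mulrC -ler_pdivlMr// ltW.
pose v g := \prod_(r <- s) cutoff n r g.
have v01 g : 0 <= v g.
  by rewrite /v big_seq prodr_ge0// => r /sP[_ r0 _]; exact: cutoff_ge0.
have q0 : 0 <= 2^-1 ^+ n :> R by rewrite exprn_ge0.
have q1 : 2^-1 ^+ n <= 1 :> R by rewrite exprn_ile1// invf_le1// ler1n.
have szE : (size s)%:R * 2^-1 ^+ n <= e :> R.
  by apply: le_trans nP; rewrite ler_wpM2r// ler_nat.
exists (fun g => (v g)%:C%C).
  by apply: real_in_prod => r /sP[Ar r0 _]; exact: real_in_cutoff.
move=> g; rewrite /indicator; have [Kg|nKg] := pselect (K (evaluation A g)).
  rewrite asboolF; last exact.
  rewrite sub0r normcN normc_real ger0_norm//.
  have [r sr rg] := sK g Kg; have [_ r0 _] := sP r sr.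
  rewrite /v (big_rem r)//=.
  have w0 : 0 <= \prod_(y <- rem r s) cutoff n y g <= 1.
    rewrite big_seq; apply/andP; split.
      by apply: prodr_ge0 => y /mem_rem/sP[_ y0 _]; exact: cutoff_ge0.
    apply: prodr_ile1 => y /mem_rem/sP[_ y0 _].
    by rewrite cutoff_ge0// cutoff_le1.
  have := cutoff_small n (r0 g) (ltW rg); have := cutoff_ge0 n (r0 g).
  have : 1 * 2^-1 ^+ n <= e.
    by apply: le_trans nP; rewrite ler_wpM2r// ler1n.
  move: w0 q0; set w := \prod_(_ <- _) _; set q := 2^-1 ^+ n; set c := cutoff _ _ _.
  by move=> /andP[]; nra.
rewrite asboolT//.
have /andP[v1 v2] : 1 - (size s)%:R * 2^-1 ^+ n <= v g <= 1.
  rewrite /v; apply: (@prod_ge_sub s (fun r => cutoff n r g)); first by rewrite q0 q1.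
  move=> r sr; have [_ r0 rK] := sP r sr.
  by rewrite cutoff_large ?cutoff_le1//; exact: rK.
have -> : (true%:R : C) = 1%:C%C by [].
rewrite -rmorphB normc_real ger0_norm ?subr_ge0//.
by rewrite lerBlDr -lerBlDl (le_trans _ v1)// lerB.
Qed.

Lemma indicator_finite K : finite_set (range (indicator K)).
Proof.
apply: (@sub_finite_set _ _ [set` [:: 0; 1 : C]]); last exact: finite_seq.
by move=> _ [h _ <-]; rewrite /indicator /= !inE; case: asbool; rewrite eqxx ?orbT.
Qed.

End Clopen.

(** * From the Ramsey property to fixed points of zero-dimensional factors *)

Section ZeroDimensionalFactors.
Context {R : realType} {L : language} {F : structure L}.
Context (A : inv_cstar_subalgebra R F).
Context (hF : ultrahomogeneous F).
Local Notation C := (R[i] : numClosedFieldType).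
Local Notation G := (aut F).
Local Notation inA := (cs_set A).

(** The Ramsey property for indicators of preimages of clopen sets V gives an
ultrafilter along which, for all g and V, the image of evaluation at h lies in
V exactly when that of evaluation at g h does. With phi the limit of the
evaluations, a clopen V containing p(phi) but not its translate by g would
contradict this. *)
Lemma ramsey_zero_dim_factor_fixed (Y : topologicalType) (actY : G -> Y -> Y) :
  ramsey A -> is_factor (gelfand_act (A := A)) actY -> zero_dim Y ->
  has_fixed_point actY.
Proof.
move=> ram [flowY [p [cp _ pE]]] [_ zY].
have clopen_p O : clopen O -> clopen (p @^-1` O).
  by move=> clO; exact: preimage_clopen clO cp.
have [|U UU UP] := @ultrafilter_of_fip G (set Y * G)%type
    (fun i => clopen i.1)
    (fun i => [set h | i.1 (p (evaluation A (i.2 * h)%g)) = i.1 (p (evaluation A h))]).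
  move=> s sP.
  have [|h hP] := ramsey_almost_invariant hF (fs := [seq indicator (p @^-1` i.1) | i <- s])
    [seq i.2 | i <- s] ram.
    move=> f /mapP[i /sP/clopen_p cli ->]; split; first exact: indicator_in.
      exact: indicator_finite.
    by apply: RUCb_stab_invariant (indicator_finite _); apply: (cs_RUCb (i := A)); exact: indicator_in.
  exists h => i si /=.
  have := hP _ _ (map_f (fun i => indicator (p @^-1` i.1)) si) (map_f snd si).
  rewrite /indicator => /eqP; rewrite eqr_nat => E.
  by apply/propext; apply: asbool_eq_equiv; move: E; rewrite /preimage /=; do 2!case: asbool.
have [phi evphi] := ultrafilter_gelfand_cvg (evaluation A) UU.
exists (p phi) => g; apply: contrapT => neq.
have nb : nbhs (p phi) (~` [set actY g (p phi)]).
  apply: open_nbhs_nbhs; split; last by move=> /esym.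
  apply: closed_openC; apply: accessible_closed_set1.
  exact: hausdorff_accessible (flow_hausdorff flowY).
have [V [clO Op] Og] := zY _ _ nb.
have cv : (fun h => p (evaluation A h)) @ U --> p phi.
  by apply: (cvg_comp _ _ evphi); exact: cp.
have cv' : (fun h => p (gelfand_act g (evaluation A h))) @ U --> p (gelfand_act g phi).
  apply: (@cvg_comp _ _ _ (evaluation A) (p \o gelfand_act g) _ _ _ evphi).
  apply: (@continuous_comp _ _ _ (gelfand_act g) p).
    exact: gelfand_act_continuous.
  exact: cp.
have U1 : U [set h | V (p (evaluation A h))].
  by apply: cv; apply: open_nbhs_nbhs; split => //; case: clO.
have U2 : U [set h | ~ V (p (gelfand_act g (evaluation A h)))].
  have nV : nbhs (p (gelfand_act g phi)) (~` V).
    apply: open_nbhs_nbhs; split; first by apply: closed_openC; case: clO.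
    by rewrite pE => /Og; exact.
  exact: (cv' _ nV).
have [h [[/= h1 h2]]] := filter_ex (filterI (filterI U1 U2) (UP (V, g) clO)).
by rewrite /= evaluationM => E; apply: h2; rewrite E.
Qed.

End ZeroDimensionalFactors.

(** * The factor defined by the finite-valued functions *)

Lemma zero_dimensional_hausdorff (T : topologicalType) :
  zero_dimensional T -> hausdorff_space T.
Proof.
move=> zT x y cl; apply/eqP; apply: contrapT => /negP /zT[U [[oU cU] Ux nUy]].
have [z [Uz nUz]] : U `&` ~` U !=set0; last exact: nUz.
by apply: cl; apply: open_nbhs_nbhs; split => //; exact: closed_openC.
Qed.

Section FiniteValuedFactor.
Context {R : realType} {L : language} {F : structure L}.
Context (A : inv_cstar_subalgebra R F).
Local Notation C := (R[i] : numClosedFieldType).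
Local Notation G := (aut F).
Local Notation inA := (cs_set A).
Implicit Types (f : G -> C) (g h : G) (phi : gelfand A).

Definition finite_valued f := inA f /\ finite_set (range f).

Lemma finite_valued_lshift g f : finite_valued f -> finite_valued (Defs.lshift g f).
Proof.
move=> [Af finf]; split; first exact: cs_lshift_subproof.
by apply: sub_finite_set finf => _ [h _ <-]; exists (g^-1 * h)%g.
Qed.

Lemma lshiftM g h f : Defs.lshift (g * h)%g f = Defs.lshift g (Defs.lshift h f).
Proof. by apply/funext => k; rewrite /Defs.lshift invgM mulgA. Qed.

Lemma lshift1 f : Defs.lshift 1%g f = f.
Proof. by apply/funext => k; rewrite /Defs.lshift invg1 mul1g. Qed.

Lemma finite_valued_lshiftE g f :
  finite_valued (Defs.lshift g f) <-> finite_valued f.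
Proof.
split; last exact: finite_valued_lshift.
by move=> /(finite_valued_lshift g^-1%g); rewrite -lshiftM mulVg lshift1.
Qed.

(** Density of evaluations, as the range is discrete. *)
Lemma cval_in_range phi f : finite_valued f -> range f (cval phi f).
Proof.
move=> [Af finf].
have finV : finite_set (range f `|` [set cval phi f]).
  by rewrite finite_setU; split => //; exact: finite_set1.
have [d d0 dP] := finite_separation finV.
have [|h /(_ f (mem_head _ _)) fh] := @evaluations_dense _ _ _ _ phi [:: f] d d0.
  by move=> u; rewrite inE => /eqP ->.
by exists h => //; apply: dP fh; [left; exists h|right].
Qed.

(** For each finite-valued f, the coordinates (f, z) record the value of phi at
f through boolean tests, so that the factor lies in a Cantor cube and its
zero-dimensionality comes for free. Functions that are not finite-valued get
the value false at all z. *)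
Definition value_test phi : {ptws ((G -> C) * C) -> bool} :=
  fun i => `[< finite_valued i.1 /\ cval phi i.1 = i.2 >].

Lemma value_testF phi f z : ~ finite_valued f -> value_test phi (f, z) = false.
Proof. by move=> nfv; apply: asboolF => -[]. Qed.

Definition finite_factor : topologicalType := set_type (range value_test).

Definition finite_proj phi : finite_factor := SigSub (mem_set (imageT value_test phi)).

Lemma finite_factor_eq (y y' : finite_factor) :
  (forall f z, set_val y (f, z) = set_val y' (f, z)) -> y = y'.
Proof. by move=> E; apply: val_inj; apply/funext => -[f z]; exact: E. Qed.

Lemma finite_projE phi i : set_val (finite_proj phi) i = value_test phi i.
Proof. by []. Qed.

Lemma finite_projP (y : finite_factor) : exists phi, y = finite_proj phi.
Proof. by have [phi _ E] := set_valP y; exists phi; apply: val_inj. Qed.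

Lemma value_test_act g phi f z :
  value_test (gelfand_act g phi) (f, z) = value_test phi (Defs.lshift g^-1%g f, z).
Proof.
rewrite /value_test /=; apply: asbool_equiv_eq; rewrite finite_valued_lshiftE.
by split=> -[[Af finf] <-]; split => //; rewrite cval_act.
Qed.

Lemma finite_act_subproof g (y : finite_factor) :
  range value_test (fun i => set_val y (Defs.lshift g^-1%g i.1, i.2)).
Proof.
have [phi ->] := finite_projP y; exists (gelfand_act g phi) => //.
by apply/funext => -[f z]; rewrite value_test_act.
Qed.

Definition finite_act g (y : finite_factor) : finite_factor :=
  SigSub (mem_set (finite_act_subproof g y)).

Lemma finite_actE g y f z :
  set_val (finite_act g y) (f, z) = set_val y (Defs.lshift g^-1%g f, z).
Proof. by []. Qed.

Lemma finite_proj_act g phi : finite_proj (gelfand_act g phi) = finite_act g (finite_proj phi).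
Proof. by apply: finite_factor_eq => f z; exact: value_test_act. Qed.

Lemma finite_factor_cvgP (T : Type) (U : set_system T) (th : T -> finite_factor)
    (y : finite_factor) : Filter U ->
  (forall i, \forall t \near U, set_val (th t) i = set_val y i) -> th @ U --> y.
Proof.
move=> FU H; apply/coordinate_cvgP => i W Wy; apply: filterS (H i) => t /= ->.
exact: nbhs_singleton.
Qed.

Lemma finite_factor_separated : zero_dimensional finite_factor.
Proof.
move=> y y' yy'.
have [i yi] : exists i, set_val y i <> set_val y' i.
  apply/existsNP => E; move/eqP: yy'; apply; apply: val_inj; exact/funext.
exists ((fun w : finite_factor => set_val w i) @^-1` [set set_val y i]); split=> //.
  apply: preimage_clopen; last exact: coordinate_continuous.
  by split; [exact: discrete_open|exact: discrete_closed].
by move=> /esym.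
Qed.

(** The values of characters at a finite-valued f lie in its finite range, so
they are locally constant in the weak topology. *)
Lemma finite_proj_continuous : continuous finite_proj.
Proof.
move=> phi; apply: (@finite_factor_cvgP _ _ _ _ (nbhs_filter phi)) => -[f z].
have [fv|nfv] := pselect (finite_valued f); last first.
  by apply: nearW => psi; rewrite !finite_projE !value_testF.
have [d d0 dP] := finite_separation fv.2.
have [+ _] := @gelfand_cvg_cval _ _ _ A _ (nbhs phi) id phi (nbhs_filter phi).
move=> /(_ (fun _ => id) f fv.1)/cvgcP/(_ d d0); apply: filterS => psi /= lt.
by rewrite !finite_projE /value_test /= (dP _ _ _ _ lt)//; exact: cval_in_range.
Qed.

Lemma finite_factor_compact : compact [set: finite_factor].
Proof.
have <- : range finite_proj = [set: finite_factor].
  by rewrite eqEsubset; split=> // y _; have [phi ->] := finite_projP y; exists phi.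
apply: continuous_compact (@gelfand_compact _ _ _ A).
exact/continuous_subspaceT/finite_proj_continuous.
Qed.

(** A finite-valued f is invariant under the stabilizer of some S. Multiplying g
on the right by s amounts to multiplying on the left by the conjugate
g s g^-1, which fixes S when s fixes the image T of S under g^-1. *)
Lemma lshift_locally_constant g f : finite_valued f ->
  \forall k \near g, Defs.lshift k^-1%g f = Defs.lshift g^-1%g f.
Proof.
move=> [Af finf]; have [S Sf] := RUCb_stab_invariant (cs_RUCb Af) finf.
have [T ST] := restr_translate S g^-1%g; exists T => s Ts.
apply/funext => h; rewrite /Defs.lshift !invgK.
have -> : (g * s * h = g * s * g^-1 * (g * h))%g by rewrite -!mulgA mulKg.
apply: Sf => x Sx /=.
by rewrite (Ts _ (ST _ Sx)) /= aut_invK.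
Qed.

(** By [lshift_locally_constant], each coordinate of the image of (k, y') is, for k
near g, a fixed coordinate of y'. *)
Lemma finite_act_continuous : continuous (fun p : G * finite_factor => finite_act p.1 p.2).
Proof.
move=> [g y]; apply: (@finite_factor_cvgP _ _ _ _ (nbhs_filter (g, y))) => -[f z] /=.
have [fv|nfv] := pselect (finite_valued f); last first.
  apply: nearW => p; have [phi ->] := finite_projP p.2; have [psi ->] := finite_projP y.
  by rewrite -!finite_proj_act !finite_projE !value_testF// finite_valued_lshiftE.
have yi : \forall y' \near y, set_val y' (Defs.lshift g^-1%g f, z) = set_val y (Defs.lshift g^-1%g f, z).
  have ny : nbhs (set_val y (Defs.lshift g^-1%g f, z)) [set set_val y (Defs.lshift g^-1%g f, z)].
    by apply: open_nbhs_nbhs; split => //; exact: discrete_open.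
  exact: (coordinate_continuous ny).
exists ([set k | Defs.lshift k^-1%g f = Defs.lshift g^-1%g f],
  [set y' | set_val y' (Defs.lshift g^-1%g f, z) = set_val y (Defs.lshift g^-1%g f, z)]).
  by split => //; exact: lshift_locally_constant.
by move=> [k y'] /= [kE yE]; rewrite !finite_actE kE yE.
Qed.

Lemma finite_factor_flow : is_flow finite_act.
Proof.
have hY := zero_dimensional_hausdorff finite_factor_separated.
split=> //.
- by exists (finite_proj (evaluation A 1%g)).
- exact: finite_factor_compact.
- by move=> y; apply: finite_factor_eq => f z; rewrite finite_actE invg1 lshift1.
- move=> g h y; apply: finite_factor_eq => f z.
  by rewrite !finite_actE invgM lshiftM.
- exact: finite_act_continuous.
Qed.

Lemma finite_factor_zero_dim : zero_dim finite_factor.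
Proof.
split; first by move=> U [].
move=> y U /(zero_dimensional_cvg (zero_dimensional_hausdorff finite_factor_separated)
  finite_factor_separated finite_factor_compact)[D [Dy clD] DU].
by exists D.
Qed.

Lemma finite_factor_is_factor : is_factor (gelfand_act (A := A)) finite_act.
Proof.
split; first exact: finite_factor_flow.
exists finite_proj; split; [exact: finite_proj_continuous| |exact: finite_proj_act].
by rewrite eqEsubset; split=> // y _; have [phi ->] := finite_projP y; exists phi.
Qed.

Lemma finite_factor_fixed : has_fixed_point finite_act ->
  exists phi, forall f, finite_valued f ->
    forall g, cval phi (Defs.lshift g f) = cval phi f.
Proof.
move=> [y yP]; have [phi yE] := finite_projP y; exists phi => f fv g.
have /(congr1 (fun w : finite_factor => set_val w (f, cval phi f))) := yP g^-1%g.
rewrite yE finite_actE !finite_projE /value_test /= invgK => E.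
by have /asboolP[] : `[< finite_valued (Defs.lshift g f) /\
  cval phi (Defs.lshift g f) = cval phi f >] by rewrite E; apply/asboolP.
Qed.

Context (hF : ultrahomogeneous F).

(** A fixed point of the factor gives a character with the same value at all
translates of a coloring in the algebra. At an h provided by density, the
colors are within d / 2 of that value, where d separates the finitely many
colors, and are therefore equal. *)
Lemma zero_dim_fixed_ramsey :
  (forall (Y : topologicalType) (actY : G -> Y -> Y),
    is_factor (gelfand_act (A := A)) actY -> zero_dim Y -> has_fixed_point actY) ->
  ramsey A.
Proof.
move=> /(_ _ _ finite_factor_is_factor finite_factor_zero_dim)/finite_factor_fixed[phi phiP].
move=> S T Cs finCs csP; apply: (ramsey_witness hF) => E.
have finV : finite_set (\bigcup_(chi in Cs) range chi).
  by apply: bigcup_finite => // chi /csP[].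
have [d d0 dP] := finite_separation finV.
have /finite_seqP[cs csE] := finCs.
have fv chi : Cs chi -> finite_valued (color_fun chi).
  move=> /csP[finchi Achi]; split => //.
  by apply: sub_finite_set finchi => _ [g _ <-]; exists (restr g^-1%g S).
have d2 : 0 < d / 2 by rewrite divr_gt0.
have [|h hP] := @almost_constant_at _ _ _ A phi [seq color_fun chi | chi <- cs] E _ d2.
  move=> _ /mapP[chi chics ->].
  have /fv[Achi finchi] : Cs chi by rewrite csE.
  by split=> //; exact: phiP.
exists h => chi Cchi g g' gE g'E; apply: dP.
- by exists chi => //; exists (restr (g * h)^-1%g S).
- by exists chi => //; exists (restr (g' * h)^-1%g S).
- have chics : chi \in cs by move: Cchi; rewrite csE.
  have := hP _ _ (map_f (@color_fun R L F S) chics) gE.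
  have := hP _ _ (map_f (@color_fun R L F S) chics) g'E.
  have := normc_triangle (cval phi (color_fun chi)) (color_fun chi (g * h)%g) (color_fun chi (g' * h)%g).
  by rewrite (normc_distC (cval phi (color_fun chi)) (color_fun chi (g' * h)%g)); lra.
Qed.

End FiniteValuedFactor.

Theorem theorem8 (R : realType) (L : language) (F : structure L)
    (hF : fraisse F) (A : inv_cstar_subalgebra R F) :
  let i := has_fixed_point (gelfand_act (A := A)) in
  let ii := forall eps : R, 0 < eps -> ramsey_upto (2 * eps) (thicken A eps) in
  let iii := forall (Y : topologicalType) (actY : aut F -> Y -> Y),
    is_factor (gelfand_act (A := A)) actY -> zero_dim Y ->
    has_fixed_point actY in
  let iv := ramsey A in
  [/\ i <-> ii, i -> iii /\ iv, iii <-> iv &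
    finite_colorings_dense A -> [/\ i <-> ii, i <-> iii & i <-> iv]].
Proof.
have [_ homF] := hF => i ii iii iv.
have i_ii : i <-> ii.
  by split; [exact: fixed_point_ramsey_upto|exact: ramsey_upto_fixed_point].
have i_iii : i -> iii.
  move=> [phi phiP] Y actY [_ [p [_ _ pE]]] _.
  by exists (p phi) => g; rewrite -pE phiP.
have iii_iv : iii <-> iv.
  split; first exact: zero_dim_fixed_ramsey.
  by move=> ram Y actY; exact: ramsey_zero_dim_factor_fixed.
split=> // [hi|dense]; first by split; [|apply/iii_iv]; exact: i_iii.
have iv_i : iv -> i by exact: dense_ramsey_fixed_point.
split=> //; first by split=> [|hiii]; [exact: i_iii|apply: iv_i; apply/iii_iv].
by split=> [hi|]; [apply/iii_iv; exact: i_iii|exact: iv_i].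
Qed.
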